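(* Suppose Assumptions (A1), (A2), (A3) hold, and either Assumption (SC) or Assumption (LIN) holds. If $x\in\mathcal{X}$ is an SCSC point, then $\lim_{t\to 0^+}\nabla_x\widetilde{\phi}_t(x)=\nabla_x\phi(x)$.
   Context: Let $f,g,h_1,\dots,h_k:\mathbb{R}^n\times\mathbb{R}^m\to\mathbb{R}$ and $\mathcal{X}\subseteq\mathbb{R}^n$. For $x\in\mathcal{X}$ let $\mathcal{Y}(x)=\{y\in\mathbb{R}^m: h_i(x,y)\le 0,\ i=1,\dots,k\}$ and let $y^*(x)=\arg\min_{y\in\mathcal{Y}(x)} g(x,y)$ (the set of lower-level solutions). The hyperfunction is $\phi(x)=\min_{y\in y^*(x)} f(x,y)$, and $\nabla_x\phi(x)=\nabla_x f(x,y^*(x))+(\nabla_x y^*(x))^\top\nabla_y f(x,y^*(x))$ where $y^*$ is single-valued and differentiable. For $t>0$ the barrier reformulated lower-level objective is $\widetilde g_t(x,y)=g(x,y)-t\sum_{i=1}^k\log(-h_i(x,y))$ (defined when $h_i(x,y)<0$ for all $i$), $y_t^*(x)=\arg\min_{y}\widetilde g_t(x,y)$, and $\widetilde\phi_t(x)=f(x,y_t^*(x))$. Assumptions: (A1) $f$ is once and $g,h_i$ are twice continuously differentiable; (A2) $\mathcal{X}$ is convex and compact and for every $x\in\mathcal{X}$ there is $y$ with $h_i(x,y)<0$ for all $i$; (A3) (LICQ) for every $x\in\mathcal{X}$ and $y\in y^*(x)$, the gradients $\{\nabla_y h_i(x,y): h_i(x,y)=0\}$ are linearly independent. (SC) for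 every $x\in\mathcal{X}$, $g(x,\cdot)$ is $\mu_g$-strongly convex and each $h_i(x,\cdot)$ is convex. (LIN) for every $x\in\mathcal{X}$, $g(x,\cdot)$ and all $h_i(x,\cdot)$ are linear (affine) in $y$, i.e. the lower-level problem is a linear program, and $\mathcal{Y}(x)$ is compact. For $y\in y^*(x)$ let $\lambda_i(x,y)\ge 0$ denote the optimal KKT Lagrange multiplier of the $i$-th constraint. A point $x$ is an SCSC (strict complementarity slackness condition) point if for every $y\in y^*(x)$ and every $i$, $h_i(x,y)=0$ implies $\lambda_i(x,y)>0$. *)

(* Defs.v *)
From HB Require Import structures.
From mathcomp Require Import all_boot all_order all_algebra.
From mathcomp Require Import all_classical all_reals all_analysis.
Set Implicit Arguments. Unset Strict Implicit. Unset Printing Implicit Defensive.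
Import Order.TTheory GRing.Theory Num.Theory.
Import numFieldNormedType.Exports.
Local Open Scope classical_set_scope.
Local Open Scope ring_scope.

Section Defs.
Variable R : realType.

Definition evec (n : nat) (i : 'I_n) : 'rV[R]_n := delta_mx 0 i.

Definition sqnorm (n : nat) (v : 'rV[R]_n) : R := \sum_(j < n) (v 0 j) ^+ 2.

Definition grad (n : nat) (F : 'rV[R]_n -> R) (x : 'rV[R]_n) : 'rV[R]_n :=
  \row_(i < n) 'D_(evec i) F x.

Definition jac (n m : nat) (Y : 'rV[R]_n -> 'rV[R]_m) (x : 'rV[R]_n) : 'M[R]_(m, n) :=
  \matrix_(j < m, i < n) ('D_(evec i) Y x) 0 j.

Definition joint (n m : nat) (F : 'rV[R]_n -> 'rV[R]_m -> R) :
  'rV[R]_n * 'rV[R]_m -> R := fun p => F p.1 p.2.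

Definition C1 (T : normedModType R) (F : T -> R) : Prop :=
  (forall p, differentiable F p) /\ (forall v, continuous (fun p => 'D_v F p)).

Definition C2 (T : normedModType R) (F : T -> R) : Prop :=
  C1 F /\ (forall v, C1 (fun p => 'D_v F p)).

Definition convex_set (n : nat) (X : set 'rV[R]_n) : Prop :=
  forall a b, X a -> X b -> forall s : R, 0 <= s <= 1 -> X (s *: a + (1 - s) *: b).

Definition convex_fun (m : nat) (F : 'rV[R]_m -> R) : Prop :=
  forall y z (s : R), 0 <= s <= 1 ->
    F (s *: y + (1 - s) *: z) <= s * F y + (1 - s) * F z.

Definition strongly_convex (m : nat) (mu : R) (F : 'rV[R]_m -> R) : Prop :=
  forall y z (s : R), 0 <= s <= 1 ->
    F (s *: y + (1 - s) *: z)
      <= s * F y + (1 - s) * F z - mu / 2 * s * (1 - s) * sqnorm (y - z).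

Definition affine_fun (m : nat) (F : 'rV[R]_m -> R) : Prop :=
  exists (c : 'rV[R]_m) (b : R), forall y, F y = \sum_(j < m) c 0 j * y 0 j + b.

Variables (n m k : nat).
Implicit Types (g f : 'rV[R]_n -> 'rV[R]_m -> R) (h : 'I_k -> 'rV[R]_n -> 'rV[R]_m -> R).

Definition feas h (x : 'rV[R]_n) : set 'rV[R]_m :=
  [set y | forall i, h i x y <= 0].
Definition sfeas h (x : 'rV[R]_n) : set 'rV[R]_m :=
  [set y | forall i, h i x y < 0].

Definition ll_sol g h (x : 'rV[R]_n) : set 'rV[R]_m :=
  [set y | feas h x y /\ forall z, feas h x z -> g x y <= g x z].

Definition gbar g h (t : R) (x : 'rV[R]_n) (y : 'rV[R]_m) : R :=
  g x y - t * \sum_(i < k) ln (- h i x y).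

Definition barrier_sol g h (t : R) (x : 'rV[R]_n) : set 'rV[R]_m :=
  [set y | sfeas h x y /\ forall z, sfeas h x z -> gbar g h t x y <= gbar g h t x z].

Definition unique_elt (T : Type) (S : set T) (y : T) : Prop :=
  S y /\ forall z, S z -> z = y.

Definition grad_y (F : 'rV[R]_n -> 'rV[R]_m -> R) x y : 'rV[R]_m := grad (F x) y.
Definition grad_x (F : 'rV[R]_n -> 'rV[R]_m -> R) x y : 'rV[R]_n :=
  grad (fun x' => F x' y) x.

Definition KKT_mult g h (x : 'rV[R]_n) (y : 'rV[R]_m) (lam : 'I_k -> R) : Prop :=
  (forall i, 0 <= lam i) /\ (forall i, lam i * h i x y = 0) /\
  grad_y g x y + \sum_(i < k) lam i *: grad_y (h i) x y = 0.

Definition SCSC g h (x : 'rV[R]_n) : Prop :=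
  forall y, ll_sol g h x y -> forall lam, KKT_mult g h x y lam ->
    forall i, h i x y = 0 -> 0 < lam i.

Definition A1 f g h : Prop :=
  C1 (joint f) /\ C2 (joint g) /\ forall i, C2 (joint (h i)).

Definition A2 h (X : set 'rV[R]_n) : Prop :=
  convex_set X /\ compact X /\ forall x, X x -> exists y, sfeas h x y.

Definition A3_LICQ g h (X : set 'rV[R]_n) : Prop :=
  forall x, X x -> forall y, ll_sol g h x y ->
    forall c : 'I_k -> R, (forall i, h i x y <> 0 -> c i = 0) ->
      \sum_(i < k) c i *: grad_y (h i) x y = 0 -> forall i, c i = 0.

Definition SC_assum g h (X : set 'rV[R]_n) (mu : R) : Prop :=
  0 < mu /\ forall x, X x ->
    strongly_convex mu (g x) /\ forall i, convex_fun (h i x).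

Definition LIN_assum g h (X : set 'rV[R]_n) : Prop :=
  forall x, X x ->
    affine_fun (g x) /\ (forall i, affine_fun (h i x)) /\ compact (feas h x).

Definition diff_selection (S : 'rV[R]_n -> set 'rV[R]_m) (X : set 'rV[R]_n)
  (x : 'rV[R]_n) (Y : 'rV[R]_n -> 'rV[R]_m) : Prop :=
  (\forall x' \near x, X x' -> unique_elt (S x') (Y x')) /\ differentiable Y x.

Definition grad_phi f (Y : 'rV[R]_n -> 'rV[R]_m) (x : 'rV[R]_n) : 'rV[R]_n :=
  grad_x f x (Y x) + grad_y f x (Y x) *m jac Y x.

Definition grad_phit f (Yt : 'rV[R]_n -> 'rV[R]_m) (x : 'rV[R]_n) : 'rV[R]_n :=
  grad (fun x' => f x' (Yt x')) x.

End Defs.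

(* Main.v *)
Require Import Defs.
From HB Require Import structures.
From mathcomp Require Import all_boot all_order all_algebra.
From mathcomp Require Import all_classical all_reals all_analysis.
From mathcomp Require Import ring lra.
Import Order.TTheory GRing.Theory Num.Theory.
Import numFieldNormedType.Exports.
Local Open Scope classical_set_scope.
Local Open Scope ring_scope.
Set Implicit Arguments.
Unset Strict Implicit.
Unset Printing Implicit Defensive.

(**
The primal-dual system [F(x, t, y, lam) = 0], with components
[grad_y g + sum_i lam_i grad_y h_i] and [lam_i h_i + t], describes both problems:
at [t = 0] it is the KKT system of the lower level, and for [t > 0] its solutions
with [lam > 0] are the minimizers of the barrier objective, with
[lam_i = - t / h_i].  At the lower-level solution over an SCSC point the partial
differential of [F] in [(y, lam)] is injective: SCSC and LICQ reduce this to the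
non-existence of a nonzero [d] orthogonal to all active gradients with zero
curvature; in case (SC) the curvature is at least [mu |d|^2], and in case (LIN)
moving along such a [d] until a new constraint becomes active reaches another
solution, at which that constraint has multiplier zero, against SCSC.  Hence the
implicit function theorem provides a map [zeta(x, t)] whose [y]-part is the
lower-level solution at [t = 0] and the barrier solution for [t > 0].

Strict differentiability, [G u - G v - L (u - v) = o(u - v)] as [u] and [v] tend
to [u0], passes from [F] to [zeta], and the derivative of a map strictly
differentiable at [u0] is continuous at [u0] wherever it exists nearby.  So
[D_x zeta(x, t)] tends to [D_x zeta(x, 0)], and the limit of the gradients follows
from the chain rule.
*)


(** * Strict differentiability *)

Section BoundedLinear.
Variable R : realType.
Implicit Types U V W : normedModType R.

(** A predicate on bare functions, so that derivatives written as explicit formulas compose without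
    being packaged; the bound is part of it because the spaces may be infinite-dimensional. *)
Definition bounded_linear V W (L : V -> W) : Prop :=
  linear L /\ exists2 C : R, 0 < C & forall v, `|L v| <= C * `|v|.

Section Pack.
Variables (V W : normedModType R) (L : V -> W).
Hypothesis bL : bounded_linear L.
Let pack : {linear V -> W} := HB.pack L (GRing.isLinear.Build _ _ _ _ _ bL.1).

Lemma blinD u v : L (u + v) = L u + L v.
Proof. exact: (linearD pack). Qed.

Lemma blinB u v : L (u - v) = L u - L v.
Proof. exact: (linearB pack). Qed.

Lemma blinZ a u : L (a *: u) = a *: L u.
Proof. exact: (linearZZ pack). Qed.

Lemma blin0 : L 0 = 0.
Proof. exact: (linear0 pack). Qed.

Lemma blin_continuous : continuous L.
Proof.
apply: (@linear_bounded_continuous R V W pack).1 => /=.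
apply/(linear_boundedP pack).
have [_ [C C0 LC]] := bL.
near=> r => v; apply: le_trans (LC v) _.
rewrite ler_wpM2r//; near: r; exact: nbhs_pinfty_ge.
Unshelve. all: by end_near. Qed.

(** Bridge from epsilon-delta estimates to Fréchet differentials: the estimate is the little-o
    expansion, and uniqueness of the differential identifies it with [L]. *)
Lemma differentiable_blin_remainder (G : V -> W) u :
  (forall e, 0 < e -> exists2 d, 0 < d &
     forall v, `|v| < d -> `|G (v + u) - G u - L v| <= e * `|v|) ->
  differentiable G u /\ forall v, 'D_v G u = L v.
Proof.
move=> H.
have E : G \o shift u = cst (G u) + pack +o_ 0 id.
  apply/eqaddoP => e e0; have [d d0 Hd] := H e e0.
  near=> v; rewrite /= !fctE opprD addrA; apply: Hd.
  near: v; exact: nbhs0_lt.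
have D : differentiable G u.
  have E' := @diff_unique R V W G pack u blin_continuous E.
  apply/diff_locallyP; rewrite E'; split; first exact: blin_continuous.
  exact: E.
split=> // v; rewrite deriveE//.
by rewrite (@diff_unique R V W G pack u blin_continuous E).
Unshelve. all: by end_near. Qed.

End Pack.

Lemma blin_comp U V W (L : U -> V) (M : V -> W) :
  bounded_linear L -> bounded_linear M -> bounded_linear (fun u => M (L u)).
Proof.
move=> bL bM; have [_ [C C0 LC]] := bL; have [_ [D D0 MD]] := bM.
split=> [a u v|]; first by rewrite bL.1 bM.1.
exists (D * C); first exact: mulr_gt0.
move=> v; apply: le_trans (MD _) _.
by rewrite -mulrA ler_wpM2l ?LC ?ltW.
Qed.

Lemma blin_add V W (L M : V -> W) :
  bounded_linear L -> bounded_linear M -> bounded_linear (fun u => L u + M u).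
Proof.
move=> bL bM; have [_ [C C0 LC]] := bL; have [_ [D D0 MD]] := bM.
split=> [a u v|]; first by rewrite bL.1 bM.1 scalerDr addrACA.
exists (C + D); first exact: addr_gt0.
by move=> v; rewrite (le_trans (ler_normD _ _))// mulrDl lerD.
Qed.

Lemma blin_scale V W (a : R) (L : V -> W) :
  bounded_linear L -> bounded_linear (fun u => a *: L u).
Proof.
move=> bL; have [_ [C C0 LC]] := bL.
split=> [b u v|]; first by rewrite bL.1 scalerDr !scalerA mulrC.
exists ((`|a| + 1) * C); first by rewrite mulr_gt0// ltr_wpDl.
move=> v; rewrite normrZ -mulrA ler_pM// lerDl//.
Qed.

Lemma blin_zero V W : bounded_linear (fun _ : V => 0 : W).
Proof.
split=> [a u v|]; first by rewrite scaler0 addr0.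
by exists 1 => // v; rewrite normr0 mul1r.
Qed.

Lemma blin_id V : bounded_linear (@id V).
Proof. by split=> //; exists 1 => // v; rewrite mul1r. Qed.

Lemma blin_fst V W : bounded_linear (fun u : V * W => u.1).
Proof.
split=> //; exists 1 => // v; rewrite mul1r prod_normE le_max lexx//.
Qed.

Lemma blin_snd V W : bounded_linear (fun u : V * W => u.2).
Proof.
split=> //; exists 1 => // v; rewrite mul1r prod_normE le_max lexx orbT//.
Qed.

Lemma blin_pair U V W (L : U -> V) (M : U -> W) :
  bounded_linear L -> bounded_linear M -> bounded_linear (fun u => (L u, M u)).
Proof.
move=> bL bM; have [_ [C C0 LC]] := bL; have [_ [D D0 MD]] := bM.
split=> [a u v|]; first by rewrite bL.1 bM.1.
exists (C + D); first exact: addr_gt0.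
move=> v; rewrite prod_normE ge_max/= mulrDl; apply/andP; split.
  by rewrite (le_trans (LC v))// lerDl mulr_ge0// ltW.
by rewrite (le_trans (MD v))// lerDr mulr_ge0// ltW.
Qed.

Lemma row_entry_le N (v : 'rV[R]_N) j : `|v 0 j| <= `|v|.
Proof.
rewrite [leRHS]/Num.Def.normr/= mx_normrE.
exact: (le_bigmax _ (fun ij : 'I_1 * 'I_N => `|v ij.1 ij.2|) (0, j)).
Qed.

Lemma row_norm_le N (v : 'rV[R]_N) (c : R) :
  0 <= c -> (forall j, `|v 0 j| <= c) -> `|v| <= c.
Proof.
move=> c0 H; rewrite [leLHS]/Num.Def.normr/= mx_normrE.
by apply: bigmax_le => // -[i j] _; rewrite /= ord1.
Qed.

Lemma blin_entry N j : bounded_linear (fun v : 'rV[R]_N => v 0 j : R).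
Proof.
split=> [a u v|]; first by rewrite !mxE.
by exists 1 => // v; rewrite mul1r row_entry_le.
Qed.

Lemma blin_row V N (L : V -> 'rV[R]_N) :
  (forall j, bounded_linear (fun v => L v 0 j : R)) -> bounded_linear L.
Proof.
move=> H; split=> [a u v|]; first by apply/rowP => j; rewrite (H j).1 !mxE.
have /choice[C HC] : forall j, exists C : R, 0 < C /\ forall v, `|L v 0 j| <= C * `|v|.
  by move=> j; have [_ [C]] := H j; exists C.
(* The summand 1 keeps the constant positive when [N] is zero. *)
exists (1 + \sum_j C j).
  by rewrite ltr_pwDl// sumr_ge0// => j _; rewrite ltW// (HC j).1.
move=> v; apply: row_norm_le => [|j].
  by rewrite mulr_ge0// addr_ge0// sumr_ge0// => j _; rewrite ltW// (HC j).1.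
rewrite (le_trans ((HC j).2 v))// ler_wpM2r// (bigD1 j)//= addrCA lerDl.
by rewrite addr_ge0// sumr_ge0// => i _; rewrite ltW// (HC i).1.
Qed.

Lemma blin_mulmx N M (A : 'M[R]_(N, M)) : bounded_linear (fun v : 'rV[R]_N => v *m A).
Proof.
apply: blin_row => j; split=> [a u v|]; first by rewrite mulmxDl -scalemxAl !mxE.
exists (1 + \sum_i `|A i j|); first by rewrite ltr_pwDl// sumr_ge0.
move=> v; rewrite mxE (le_trans (ler_norm_sum _ _ _))// mulrDl mul1r.
rewrite -[leLHS]add0r lerD// mulr_suml ler_sum// => i _.
by rewrite normrM mulrC ler_wpM2l// row_entry_le.
Qed.

End BoundedLinear.

Section StrictDifferentiability.
Variable R : realType.
Implicit Types U V W : normedModType R.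

Definition strict_diff V W (G : V -> W) (u0 : V) (L : V -> W) : Prop :=
  bounded_linear L /\ forall e : R, 0 < e -> exists2 d : R, 0 < d &
    forall u v, `|u - u0| < d -> `|v - u0| < d ->
      `|G u - G v - L (u - v)| <= e * `|u - v|.

Lemma strict_diff_lipschitz V W (G : V -> W) u0 L : strict_diff G u0 L ->
  exists2 C : R, 0 < C & exists2 d : R, 0 < d &
    forall u v, `|u - u0| < d -> `|v - u0| < d -> `|G u - G v| <= C * `|u - v|.
Proof.
move=> [[_ [C C0 LC]] /(_ 1 ltr01)[d d0 H]].
exists (1 + C); first exact: addr_gt0.
exists d => // u v ud vd.
rewrite -[X in `|X|](subrK (L (u - v))) (le_trans (ler_normD _ _))// mulrDl.
by rewrite lerD// H.
Qed.

Lemma strict_diff_continuous V W (G : V -> W) u0 L : strict_diff G u0 L ->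
  forall e : R, 0 < e -> exists2 d : R, 0 < d & forall u, `|u - u0| < d -> `|G u - G u0| < e.
Proof.
move=> /strict_diff_lipschitz[C C0 [d d0 H]] e e0.
exists (Num.min d (e / C)); first by rewrite lt_min d0 divr_gt0.
move=> u; rewrite lt_min => /andP[ud ue].
rewrite (le_lt_trans (H _ _ ud _))//; first by rewrite subrr normr0.
by rewrite mulrC -ltr_pdivlMr.
Qed.

Lemma strict_diff_differentiable V W (G : V -> W) u0 L : strict_diff G u0 L ->
  differentiable G u0 /\ forall v, 'D_v G u0 = L v.
Proof.
move=> [bL H]; apply: (differentiable_blin_remainder bL) => e /H[d d0 Hd].
exists d => // v vd; have := Hd (v + u0) u0.
by rewrite addrK subrr normr0; apply.
Qed.

Lemma strict_diff_blin V W (L : V -> W) u0 : bounded_linear L -> strict_diff L u0 L.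
Proof.
move=> bL; split=> // e e0; exists 1 => // u v _ _.
by rewrite (blinB bL) subrr normr0 mulr_ge0// ltW.
Qed.

Lemma strict_diff_comp U V W (G : U -> V) (K : V -> W) u0 L M :
  strict_diff G u0 L -> strict_diff K (G u0) M ->
  strict_diff (fun u => K (G u)) u0 (fun v => M (L v)).
Proof.
move=> sG sK; have [bL HG] := sG; have [bM HK] := sK.
split; first exact: blin_comp.
move=> e e0; have [_ [D D0 MD]] := bM.
have [C C0 [d1 d10 Hlip]] := strict_diff_lipschitz sG.
have e2 : 0 < e / 2 by rewrite divr_gt0.
have [d2 d20 H2] := HK _ (divr_gt0 e2 C0).
have [d3 d30 H3] := HG _ (divr_gt0 e2 D0).
have [d4 d40 H4] := strict_diff_continuous sG d20.
exists (Num.min (Num.min d1 d3) d4); first by rewrite !lt_min d10 d30 d40.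
move=> u v; rewrite !lt_min => /andP[/andP[u1 u3] u4] /andP[/andP[v1 v3] v4].
(* The remainder of [K] is measured against [G u - G v], at most [C * |u - v|]; the remainder of [G]
   is enlarged by [M] by a factor at most [D]. This explains the tolerances [e / 2 / C] and
   [e / 2 / D]. *)
have -> : K (G u) - K (G v) - M (L (u - v)) = (K (G u) - K (G v) - M (G u - G v))
    + M (G u - G v - L (u - v)).
  by rewrite (blinB bM _ (L _)) addrA subrK.
rewrite (le_trans (ler_normD _ _))// [e]splitr mulrDl lerD//.
  rewrite (le_trans (H2 _ _ (H4 _ u4) (H4 _ v4)))//.
  rewrite (le_trans (ler_wpM2l _ (Hlip _ _ u1 v1)))//.
    by rewrite divr_ge0 ?divr_ge0 ?ltW.
  by rewrite mulrA divfK// gt_eqF.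
rewrite (le_trans (MD _))// (le_trans (ler_wpM2l _ (H3 _ _ u3 v3)))//.
  exact: ltW.
by rewrite mulrA mulrCA divff ?gt_eqF// mulr1.
Qed.

Lemma strict_diff_add V W (G K : V -> W) u0 L M :
  strict_diff G u0 L -> strict_diff K u0 M ->
  strict_diff (fun u => G u + K u) u0 (fun v => L v + M v).
Proof.
move=> [bL HG] [bM HK]; split; first exact: blin_add.
move=> e e0; have e2 : 0 < e / 2 by rewrite divr_gt0.
have [d1 d10 H1] := HG _ e2; have [d2 d20 H2] := HK _ e2.
exists (Num.min d1 d2); first by rewrite lt_min d10 d20.
move=> u v; rewrite !lt_min => /andP[u1 u2] /andP[v1 v2].
have -> : G u + K u - (G v + K v) - (L (u - v) + M (u - v)) =
  (G u - G v - L (u - v)) + (K u - K v - M (u - v)).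
  by rewrite (opprD (G v)) (addrACA (G u)) (opprD (L _)) [LHS]addrACA.
by rewrite (le_trans (ler_normD _ _))// [e]splitr mulrDl lerD ?H1 ?H2.
Qed.

End StrictDifferentiability.

(** * Rules for strict derivatives, and strict differentiability of [C1] functions *)

Section StrictCalculus.
Variable R : realType.
Implicit Types U V W : normedModType R.

Lemma strict_diff_sum V W (I : finType) (G : I -> V -> W) u0 (L : I -> V -> W) :
  (forall i, strict_diff (G i) u0 (L i)) ->
  strict_diff (fun u => \sum_i G i u) u0 (fun v => \sum_i L i v).
Proof.
move=> H; rewrite /index_enum; elim: (Finite.enum I) => [|i s IH].
  have -> : (fun u => \sum_(i <- [::]) G i u) = (fun _ : V => 0 : W).
    by apply/funext => u; rewrite big_nil.
  have -> : (fun u => \sum_(i <- [::]) L i u) = (fun _ : V => 0 : W).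
    by apply/funext => u; rewrite big_nil.
  exact: strict_diff_blin (blin_zero _ _).
have -> : (fun u => \sum_(i <- i :: s) G i u) = (fun u => G i u + \sum_(i <- s) G i u).
  by apply/funext => u; rewrite big_cons.
have -> : (fun u => \sum_(i <- i :: s) L i u) = (fun u => L i u + \sum_(i <- s) L i u).
  by apply/funext => u; rewrite big_cons.
exact: strict_diff_add.
Qed.

Lemma strict_diff_pair U V W (G : U -> V) (K : U -> W) u0 L M :
  strict_diff G u0 L -> strict_diff K u0 M ->
  strict_diff (fun u => (G u, K u)) u0 (fun v => (L v, M v)).
Proof.
move=> [bL HG] [bM HK]; split; first exact: blin_pair.
move=> e e0; have [d1 d10 H1] := HG _ e0; have [d2 d20 H2] := HK _ e0.
exists (Num.min d1 d2); first by rewrite lt_min d10 d20.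
move=> u v; rewrite !lt_min => /andP[u1 u2] /andP[v1 v2].
by rewrite prod_normE ge_max/= H1// H2.
Qed.

Lemma strict_diff_row V N (G : V -> 'rV[R]_N) u0 (L : V -> 'rV[R]_N) :
  (forall j, strict_diff (fun u => G u 0 j : R) u0 (fun v => L v 0 j : R)) ->
  strict_diff G u0 L.
Proof.
move=> H; split; first by apply: blin_row => j; exact: (H j).1.
move=> e e0.
have /choice[d Hd] : forall j, exists d : R, 0 < d /\ forall u v,
    `|u - u0| < d -> `|v - u0| < d ->
    `|G u 0 j - G v 0 j - L (u - v) 0 j| <= e * `|u - v|.
  by move=> j; have [_ /(_ e e0)[d d0 Hd]] := H j; exists d.
(* The default 1 gives a positive radius also when there are no columns. *)
exists (\big[Num.min/1]_j d j).
  by elim/big_ind : _ => // [x y x0 y0|j _]; [rewrite lt_min x0 y0|exact: (Hd j).1].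
move=> u v ud vd; apply: row_norm_le => [|j]; first by rewrite mulr_ge0// ltW.
rewrite !mxE; have le_d : \big[Num.min/1]_j d j <= d j by exact: bigmin_le.
by apply: (Hd j).2; exact: lt_le_trans le_d.
Qed.

(** By composition with the pair of [G] and [K], only multiplication on the plane is left; its
    remainder is a sum of two products, each with one factor that is small near the base point. *)
Lemma strict_diff_mul V (G K : V -> R) u0 L M :
  strict_diff G u0 L -> strict_diff K u0 M ->
  strict_diff (fun u => G u * K u : R) u0 (fun v => L v * K u0 + G u0 * M v : R).
Proof.
move=> sG sK; pose p0 := (G u0, K u0).
suff sM : @strict_diff R (R * R)%type R (fun p => p.1 * p.2) p0
    (fun q => q.1 * p0.2 + p0.1 * q.2).
  exact: (strict_diff_comp (strict_diff_pair sG sK) sM).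
split.
  apply: blin_add.
    have -> : (fun q : R * R => q.1 * p0.2) = (fun q => p0.2 *: (q.1 : R)).
      by apply/funext => q; rewrite mulrC.
    exact/blin_scale/blin_fst.
  exact: (@blin_scale R (R * R)%type R p0.1 _ (blin_snd _ _)).
move=> e e0; exists (e / 2) => [|u v]; first by rewrite divr_gt0.
rewrite !prod_normE/= !gt_max => /= /andP[u1 u2] /andP[v1 v2].
rewrite -/(G u0) -/(K u0).
have -> : u.1 * u.2 - v.1 * v.2 - ((u.1 - v.1) * K u0 + G u0 * (u.2 - v.2)) =
  (u.1 - v.1) * (v.2 - K u0) + (u.1 - G u0) * (u.2 - v.2) by ring.
apply: le_trans (ler_normD _ _) _; rewrite !normrM [e]splitr mulrDl; apply: lerD.
  by rewrite mulrC; apply: ler_pM => //; [exact: ltW|rewrite le_max lexx].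
by apply: ler_pM => //; [exact: ltW|rewrite le_max lexx orbT].
Qed.

Lemma derive_line V (G : V -> R) (p w : V) (s : R) :
  differentiable G (p + s *: w) ->
  is_derive s 1 (fun s : R => G (p + s *: w)) ('D_w G (p + s *: w)).
Proof.
move=> dG.
have E : (fun h : R => h^-1 *: (((fun s : R => G (p + s *: w)) \o shift s) (h *: (1 : R)) -
   G (p + s *: w))) = (fun h => h^-1 *: ((G \o shift (p + s *: w)) (h *: w) - G (p + s *: w))).
  apply/funext => h /=; rewrite scaler1 scalerDl addrA (addrC p) -addrA (addrC p).
  by [].
split; first by rewrite /derivable E; exact: diff_derivable.
by rewrite /derive E.
Qed.

Lemma mean_value_line V (G : V -> R) (p w : V) :
  (forall q, differentiable G q) ->
  exists2 s : R, 0 <= s <= 1 & G (p + w) - G p = 'D_w G (p + s *: w).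
Proof.
move=> dG.
have [|s|s sI] := @MVT_segment R (fun s => G (p + s *: w))
    (fun s => 'D_w G (p + s *: w)) 0 1 ler01.
- by move=> s _; exact: derive_line.
- apply: continuous_subspaceT => s'.
  apply: differentiable_continuous; apply/derivable1_diffP.
  exact: (@ex_derive _ _ _ _ _ _ _ (derive_line (dG _))).
by rewrite scale1r scale0r addr0 subr0 mulr1 => E; exists s.
Qed.

Section Pair.
Variables n m : nat.
Local Notation T := ('rV[R]_n * 'rV[R]_m)%type.

Lemma pair_basis (v : T) :
  v = \sum_i v.1 0 i *: (evec R i, 0) + \sum_j v.2 0 j *: (0, evec R j).
Proof.
case: v => a b; rewrite {1}[a]row_sum_delta {1}[b]row_sum_delta /=.
have -> : \sum_i a 0 i *: (evec R i, 0 : 'rV[R]_m) = (\sum_i a 0 i *: evec R i, 0).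
  elim/big_rec2 : _ => // i x y _ ->; congr pair => /=; by rewrite scaler0 addr0.
have -> : \sum_i b 0 i *: (0 : 'rV[R]_n, evec R i) = (0, \sum_i b 0 i *: evec R i).
  elim/big_rec2 : _ => // i x y _ ->; congr pair => /=; by rewrite scaler0 addr0.
by congr pair => /=; rewrite (addr0, add0r).
Qed.

Lemma diff_pair_basis (G : T -> R) p (v : T) : differentiable G p ->
  'D_v G p = \sum_i v.1 0 i * 'D_((evec R i, 0) : T) G p +
             \sum_j v.2 0 j * 'D_((0, evec R j) : T) G p.
Proof.
move=> dG; rewrite !deriveE// {1}[v]pair_basis linearD !linear_sum; congr (_ + _).
  by apply: eq_bigr => i _; rewrite linearZ deriveE.
by apply: eq_bigr => i _; rewrite linearZ deriveE.
Qed.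

(** By the mean value theorem on the segment from [v] to [u], the remainder is a difference of
    directional derivatives at a point of the segment and at [u0]. Expanding the direction in the
    finite basis makes the bound uniform in the direction, although [C1] gives continuity one
    direction at a time. *)
Lemma C1_strict_diff (G : T -> R) u0 : C1 G -> strict_diff G u0 (fun v => 'D_v G u0).
Proof.
move=> [dG cG].
have E : (fun v => 'D_v G u0) = 'd G u0 :> (T -> R) by apply/funext => v; rewrite deriveE.
split.
  rewrite E; split; first exact: linearP.
  exact: (linear_lipschitz (diff_continuous (dG u0))).
move=> e e0.
(* [S q] is the total variation of the partial derivatives between [u0] and [q]; it is continuous at
   [u0] and vanishes there. *)
pose S (q : T) : R := \sum_i `|'D_((evec R i, 0) : T) G q - 'D_((evec R i, 0) : T) G u0| +
  \sum_j `|'D_((0, evec R j) : T) G q - 'D_((0, evec R j) : T) G u0|.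
have cS : S q @[q --> u0] --> S u0.
  apply: cvgD; apply: cvg_big => //; do ?[exact: add_continuous | move=> i _];
    by apply: cvg_norm; apply: cvgB; [exact: cG|exact: cvg_cst].
have S0 : S u0 = 0.
  by rewrite /S !big1 ?addr0// => i _; rewrite subrr normr0.
move: cS; rewrite S0 => /cvgrPdist_lt/(_ e e0)/nbhs_ballP[d /= d0 Hd].
exists d => // u v ud vd.
have [s /andP[s0 s1]] := mean_value_line v (u - v) dG.
rewrite (addrC v) subrK => ->; set q := v + _.
have Bq : ball u0 d q.
  rewrite -ball_normE/= /ball_/= distrC.
  have -> : q - u0 = s *: (u - u0) + (1 - s) *: (v - u0).
    by apply: injective_projections; apply/rowP => j; rewrite /q /= !mxE; ring.
  rewrite (le_lt_trans (ler_normD _ _))// !normrZ (ger0_norm s0) ger0_norm ?subr_ge0//.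
  have [->|s0'] := eqVneq s 0; first by rewrite mul0r add0r subr0 mul1r.
  have : s * `|u - u0| < s * d by rewrite ltr_pM2l// lt_def s0'.
  have : (1 - s) * `|v - u0| <= (1 - s) * d by rewrite ler_wpM2l ?subr_ge0// ltW.
  lra.
have /ltW := Hd _ Bq; rewrite sub0r normrN => Sq.
rewrite !diff_pair_basis//.
have -> : forall a b c f : R, a + b - (c + f) = (a - c) + (b - f) by move=> *; ring.
rewrite -!sumrB (le_trans (ler_normD _ _))//.
apply: le_trans (_ : S q * `|u - v| <= _).
  rewrite /S mulrDl !mulr_suml; apply: lerD; rewrite (le_trans (ler_norm_sum _ _ _))//;
    apply: ler_sum => i _; rewrite -mulrBr normrM mulrC ler_wpM2l//.
    rewrite (le_trans (row_entry_le _ _))// prod_normE le_max lexx//.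
  rewrite (le_trans (row_entry_le _ _))// prod_normE le_max lexx orbT//.
rewrite ler_wpM2r// -(ger0_norm (_ : 0 <= S q))//.
by rewrite addr_ge0// sumr_ge0.
Qed.
End Pair.
End StrictCalculus.

(** Banach's fixed point theorem is applied below in this space, which must be complete for its
    norm. *)
HB.instance Definition _ (R : realType) N := Complete.on 'rV[R]_N.

(** * The implicit function theorem *)

Section ImplicitFunction.
Variable R : realType.

Lemma pair_norm_lt (V W : normedModType R) (a : V) (b : W) (d : R) :
  (`|(a, b)| < d) = (`|a| < d) && (`|b| < d).
Proof. by rewrite prod_normE gt_max. Qed.

(** In finite dimension the matrix of an injective endomorphism is invertible, and multiplication by
    its inverse is bounded. *)
Lemma blin_inverse N (L : 'rV[R]_N -> 'rV[R]_N) :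
  bounded_linear L -> (forall w, L w = 0 -> w = 0) ->
  exists2 B : 'rV[R]_N -> 'rV[R]_N, bounded_linear B & cancel L B /\ cancel B L.
Proof.
move=> bL injL.
pose pk : {linear _ -> _} := HB.pack L (GRing.isLinear.Build _ _ _ _ _ bL.1).
have E w : w *m lin1_mx pk = L w by rewrite mul_rV_lin1.
have uA : lin1_mx pk \in unitmx.
  rewrite -row_free_unit; apply: inj_row_free => v; rewrite E; exact: injL.
exists (fun w => w *m invmx (lin1_mx pk)); first exact: blin_mulmx.
by split=> w; rewrite -E (mulmxK, mulmxKV).
Qed.

Variable P : normedModType R.

Section Fixed.
Variables (N : nat) (F : P * 'rV[R]_N -> 'rV[R]_N) (p0 : P) (z0 : 'rV[R]_N)
  (L : P * 'rV[R]_N -> 'rV[R]_N).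
Hypothesis sF : strict_diff F (p0, z0) L.
Hypothesis injL : forall w, L (0, w) = 0 -> w = 0.

Let blin_L2 : bounded_linear (fun w => L (0, w)).
Proof.
exact: (blin_comp (blin_pair (blin_zero _ _) (blin_id _)) sF.1).
Qed.

(** Suppose [L1 (0, w) = 0] with [w] nonzero. Along a short step [s *: w], strictness at [u1] bounds
    the increment of [F] by [|s w| / (4 C)], strictness at [(p0, z0)] puts it within [|s w| / (2 C)]
    of [L (0, s *: w)], and the latter has norm at least [|s w| / C]. Together these give
    [1 <= 3/4]. *)
Lemma nearby_injective :
  exists2 d : R, 0 < d & forall u1 L1, `|u1 - (p0, z0)| < d -> strict_diff F u1 L1 ->
    forall w, L1 (0, w) = 0 -> w = 0.
Proof.
have [B [_ [C C0 BC]] [LB _]] := blin_inverse blin_L2 injL.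
have iC : 0 < (2 * C)^-1 by rewrite invr_gt0 mulr_gt0.
have [d d0 Hd] := sF.2 _ iC.
exists (d / 2) => [|u1 L1]; first by rewrite divr_gt0.
case: u1 => p z pzd sF1 w Lw0; apply/eqP/negPn/negP => wN0.
have iC4 : 0 < (4 * C)^-1 by rewrite invr_gt0 mulr_gt0.
have [d1 d10 Hd1] := sF1.2 _ iC4.
have nw : 0 < `|w| by rewrite normr_gt0.
(* The step has norm half of the minimum, so both remainder estimates apply to it. *)
pose s := Num.min d1 (d / 2) / 2 / `|w|.
have s0 : 0 < s by rewrite !divr_gt0// lt_min d10 divr_gt0.
have nsw : `|s *: w| = Num.min d1 (d / 2) / 2.
  by rewrite normrZ gtr0_norm// /s divfK// gt_eqF.
have hm : 0 < Num.min d1 (d / 2) by rewrite lt_min d10 divr_gt0.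
have sw1 : `|s *: w| < d1.
  rewrite nsw; apply: (@lt_le_trans _ _ (Num.min d1 (d / 2))); last by rewrite ge_min lexx.
  lra.
have sw2 : `|s *: w| < d / 2.
  rewrite nsw; apply: (@lt_le_trans _ _ (Num.min d1 (d / 2))); last by rewrite ge_min lexx orbT.
  lra.
pose u := (p, z + s *: w).
have Eu : u - (p, z) = (0, s *: w).
  by congr pair; rewrite /= ?subrr// addrC addKr.
have Nu : `|u - (p, z)| = `|s *: w| by rewrite Eu prod_normE normr0 max_r.
have := Hd1 u (p, z); rewrite Nu subrr normr0 => /(_ sw1 d10).
rewrite Eu.
have -> : (0 : P, s *: w) = s *: (0, w) by congr pair; rewrite /= scaler0.
rewrite (blinZ sF1.1) Lw0 scaler0 subr0 => H1.
have := Hd u (p, z).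
have -> : u - (p0, z0) = (u - (p, z)) + ((p, z) - (p0, z0)) by rewrite addrA subrK.
rewrite Nu => /(_ _ _)/wrap[].
  by rewrite (le_lt_trans (ler_normD _ _))// Nu [d]splitr ltrD.
  by rewrite (lt_trans pzd)// ltr_pdivrMr// ltr_pMr// ltr1n.
rewrite Eu => H2.
have H3 : `|s *: w| <= C * `|L (0, s *: w)| by rewrite -{1}(LB (s *: w)) BC.
have H4 : `|L (0, s *: w)| <= `|F u - F (p, z)| + `|F u - F (p, z) - L (0, s *: w)|.
  rewrite -{1}(subKr (F u - F (p, z)) (L (0, s *: w))) (le_trans (ler_normB _ _))//.
have H5 : `|L (0, s *: w)| <= (4 * C)^-1 * `|s *: w| + (2 * C)^-1 * `|s *: w|.
  by rewrite (le_trans H4)// lerD.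
have : `|s *: w| <= C * ((4 * C)^-1 * `|s *: w| + (2 * C)^-1 * `|s *: w|).
  by rewrite (le_trans H3)// ler_wpM2l// ltW.
have -> : C * ((4 * C)^-1 * `|s *: w| + (2 * C)^-1 * `|s *: w|) = 3 / 4 * `|s *: w|.
  by field; rewrite gt_eqF.
have : 0 < `|s *: w| by rewrite normr_gt0 scaler_eq0 negb_or wN0 gt_eqF.
lra.
Qed.

End Fixed.

(** Composing [F] with the inverse [B] of its partial derivative gives a map [Phi] whose partial
    derivative in [z] is the identity. Zeros of [F] over [p] are then fixed points of
    [z - Phi (p, z)], a contraction of factor 1/2 on a small closed ball. *)
Theorem implicit_function N (F : P * 'rV[R]_N -> 'rV[R]_N) p0 z0 L :
  F (p0, z0) = 0 -> strict_diff F (p0, z0) L -> (forall w, L (0, w) = 0 -> w = 0) ->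
  exists zeta : P -> 'rV[R]_N, exists r d : R, [/\ 0 < r, 0 < d & zeta p0 = z0] /\
    [/\ (forall p, `|p - p0| < r -> F (p, zeta p) = 0 /\ `|zeta p - z0| < d),
    (forall p z, `|p - p0| < r -> `|z - z0| < d -> F (p, z) = 0 -> z = zeta p) &
    exists M, strict_diff zeta p0 M].
Proof.
move=> F0 sF injL.
have bL2 : bounded_linear (fun w => L (0, w)).
  exact: (blin_comp (blin_pair (blin_zero _ _) (blin_id _)) sF.1).
have [B bB [LB BL]] := blin_inverse bL2 injL.
have pairB (a b : P) (x y : 'rV[R]_N) : (a, x) - (b, y) = (a - b, x - y) by [].
have injB z : B z = 0 -> z = 0.
  by move=> Bz; rewrite -(BL z) Bz (blin0 bL2).
have sPhi := strict_diff_comp sF (strict_diff_blin (F (p0, z0)) bB).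
set Phi := (fun u => B (F u)) in sPhi; set M := (fun u => B (L u)) in sPhi.
have [bM HM] := sPhi.
pose Lp (q : P) := M (q, 0).
have bLp : bounded_linear Lp.
  exact: (blin_comp (blin_pair (blin_id _) (blin_zero _ _)) bM).
have ME q w : M (q, w) = Lp q + w.
  have -> : (q, w) = (q, 0) + (0, w) by congr pair; rewrite /= ?addr0 ?add0r.
  by rewrite (blinD bM) {2}/M LB.
have [_ [C C0 LC]] := bLp.
have h2 : 0 < 2^-1 :> R by rewrite invr_gt0.
have [d d0 Hd] := HM _ h2.
(* For two zeros, strictness with constant 1/2 gives [|z - z'| <= (C + 1/2) |p - p'| + |z - z'| /
   2]; solving for [|z - z'|] yields this Lipschitz constant. *)
pose K := 2 * C + 1; have K0 : 0 < K by rewrite addr_gt0 ?mulr_gt0.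
have lip p z p' z' : `|p - p0| < d -> `|z - z0| < d -> `|p' - p0| < d -> `|z' - z0| < d ->
    F (p, z) = 0 -> F (p', z') = 0 -> `|z - z'| <= K * `|p - p'|.
  move=> pd zd pd' zd' Fz Fz'.
  have := Hd (p, z) (p', z'); rewrite !pair_norm_lt pd zd pd' zd' => /(_ isT isT).
  rewrite /Phi Fz Fz' subrr sub0r normrN ME => H.
  have H1 : `|z - z'| <= `|Lp (p - p') + (z - z')| + `|Lp (p - p')|.
    by rewrite -{1}[z - z'](addKr (Lp (p - p'))) addrC (le_trans (ler_normB _ _)).
  have H2 := LC (p - p').
  have H3 : `|(p - p', z - z')| <= `|p - p'| + `|z - z'|.
    by rewrite prod_normE ge_max lerDl lerDr !normr_ge0.
  rewrite /K; lra.
pose rho := d / 2; have rho0 : 0 < rho by rewrite divr_gt0.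
(* With this radius [|Phi (p, z0)| <= rho / 2], so the contraction maps the ball of radius [rho] to
   itself. *)
pose r := Num.min d (rho / (2 * (C + 1))).
have r0 : 0 < r by rewrite lt_min d0 divr_gt0// mulr_gt0// addr_gt0.
have ex p : `|p - p0| < r -> exists2 z, `|z - z0| <= rho & F (p, z) = 0.
  rewrite lt_min => /andP[pd pr].
  pose U := closed_ball_ Num.norm z0 rho.
  pose T z := z - Phi (p, z).
  have UE z : U z = (`|z - z0| <= rho) :> Prop by rewrite /U /closed_ball_/= distrC.
  have Ud z : U z -> `|z - z0| < d.
    by rewrite UE => /le_lt_trans; apply; rewrite ltr_pdivrMr// ltr_pMr// ltr1n.
  have ctr z z' : U z -> U z' -> `|T z - T z'| <= 2^-1 * `|z - z'|.
    move=> Uz Uz'; have := Hd (p, z) (p, z').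
    rewrite !pair_norm_lt pd !Ud// => /(_ isT isT).
    rewrite !pairB ME subrr (blin0 bLp) add0r prod_normE/= normr0 max_r//.
    rewrite /T opprB addrA -normrN; congr (`|_| <= _).
    by rewrite !opprB addrA !opprD !opprK; apply/rowP => j; rewrite !mxE; ring.
  have TU : {homo T : z / U z >-> U z}.
    move=> z Uz; rewrite UE.
    have -> : T z - z0 = (T z - T z0) - Phi (p, z0).
      by rewrite /T; apply/rowP => j; rewrite !mxE; ring.
    have Uz0 : U z0 by rewrite UE subrr normr0 ltW.
    rewrite (le_trans (ler_normB _ _))//.
    have H1 := ctr _ _ Uz Uz0; move: (Uz); rewrite UE => H2.
    have := Hd (p, z0) (p0, z0).
    rewrite !pair_norm_lt pd !subrr !normr0 d0 => /(_ isT isT).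
    rewrite {2}/Phi F0 (blin0 bB) subr0 !pairB ME subrr addr0 prod_normE/= normr0 max_l// => H3.
    have H4 := LC (p - p0).
    have H5 : `|Phi (p, z0)| <= `|Phi (p, z0) - Lp (p - p0)| + `|Lp (p - p0)|.
      by rewrite -{1}[Phi _](subrK (Lp (p - p0))) ler_normD.
    move: pr; rewrite ltr_pdivlMr ?mulr_gt0// ?addr_gt0// => pr.
    have := normr_ge0 (p - p0).
    lra.
  pose f : {fun U >-> U} := mkfun TU.
  have cf : is_contraction f.
    have h0 : 0 <= 2^-1 :> R by rewrite ltW.
    exists (NngNum h0); split; first by rewrite /= invf_lt1// ltr1n.
    by case=> z z' [/= Uz Uz']; exact: ctr.
  have [||z Uz fz] := banach_fixed_point cf.
  - exact: closed_closed_ball_.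
  - by exists z0; rewrite UE subrr normr0 ltW.
  exists z; first by rewrite -UE.
  apply: injB; rewrite -/(Phi _).
  move: fz; rewrite /= /T => /eqP; rewrite eq_sym subr_eq addrC -subr_eq subrr => /eqP.
  by [].
have /choice[zeta Hz] : forall p, exists z, `|p - p0| < r -> `|z - z0| <= rho /\ F (p, z) = 0.
  move=> p; have [pr|_] := boolP (`|p - p0| < r); last by exists 0.
  by have [z z1 z2] := ex p pr; exists z.
have rd p : `|p - p0| < r -> `|p - p0| < d by rewrite lt_min => /andP[].
have rhod : rho < d by rewrite ltr_pdivrMr// ltr_pMr// ltr1n.
have zd p : `|p - p0| < r -> `|zeta p - z0| < d.
  by move=> /Hz[/le_lt_trans + _]; apply.
have p00 : `|p0 - p0| < r by rewrite subrr normr0.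
have z00 : `|z0 - z0| < d by rewrite subrr normr0.
have uniq p z : `|p - p0| < r -> `|z - z0| < d -> F (p, z) = 0 -> z = zeta p.
  move=> pr zd' Fz; apply/eqP; rewrite -subr_eq0 -normr_le0.
  have := lip p z p (zeta p) (rd _ pr) zd' (rd _ pr) (zd _ pr) Fz (Hz _ pr).2.
  by rewrite subrr normr0 mulr0.
exists zeta, r, d; split; first by split => //; rewrite -(uniq p0 z0).
split => //.
- by move=> p pr; split; [exact: (Hz _ pr).2|exact: zd].
(* The derivative of [zeta] solves [Lp q + w = 0]. Since [zeta] is [K]-Lipschitz, passing to the
   graph multiplies distances by at most [K + 1], whence the divisions by [K + 1] below. *)
exists (fun q => - Lp q); split.
  by have := blin_scale (-1) bLp; under eq_fun do rewrite scaleN1r.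
move=> e e0.
have K10 : 0 < K + 1 by rewrite (addr_gt0 K0).
have e'0 : 0 < e / (K + 1) by rewrite divr_gt0 ?K10.
have [d1 d10 Hd1] := HM _ e'0.
exists (Num.min r (d1 / (K + 1))) => [|u v].
  by rewrite lt_min r0 divr_gt0 ?K10.
have rK w : `|w - p0| < Num.min r (d1 / (K + 1)) ->
    `|w - p0| < r /\ `|w - p0| * (K + 1) < d1.
  by rewrite lt_min => /andP[? H]; split => //; rewrite -ltr_pdivlMr.
move=> /rK[ur ud] /rK[vr vd].
have z0E : zeta p0 = z0 by rewrite -(uniq p0 z0).
have zl w : `|w - p0| < r -> `|w - p0| * (K + 1) < d1 -> `|(w, zeta w) - (p0, z0)| < d1.
  move=> wr wd; rewrite pair_norm_lt; apply/andP; split.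
    by apply: le_lt_trans wd; rewrite ler_peMr// lerDr ltW.
  have := lip w (zeta w) p0 z0 (rd _ wr) (zd _ wr) (rd _ p00) z00 (Hz _ wr).2 F0.
  have := normr_ge0 (w - p0); lra.
have := Hd1 _ _ (zl _ ur ud) (zl _ vr vd).
rewrite /Phi (Hz _ ur).2 (Hz _ vr).2 subrr sub0r normrN ME opprK [in X in X -> _]addrC.
move=> /le_trans; apply.
have := lip u (zeta u) v (zeta v) (rd _ ur) (zd _ ur) (rd _ vr) (zd _ vr) (Hz _ ur).2 (Hz _ vr).2.
move=> Hl; rewrite -mulrA; apply: ler_wpM2l; first exact: ltW.
rewrite ler_pdivrMl//.
rewrite pairB prod_normE/= ge_max; apply/andP; split.
  by rewrite ler_peMl// lerDr ltW.
by rewrite (le_trans Hl)// ler_wpM2r// lerDl.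
Qed.
End ImplicitFunction.

(** * Differentiability of the implicit function at all nearby points, and continuity of
    derivatives *)

Section Nearby.
Variable R : realType.

Lemma strict_diff_cst (V W : normedModType R) (c : W) (u0 : V) :
  strict_diff (fun _ => c) u0 (fun _ => 0).
Proof.
split; first exact: blin_zero.
by move=> e e0; exists 1 => // u v _ _; rewrite !subrr normr0 mulr_ge0// ltW.
Qed.

Lemma strict_diff_near_eq (V W : normedModType R) (G K : V -> W) (u0 : V) L (d : R) :
  0 < d -> (forall u, `|u - u0| < d -> G u = K u) -> strict_diff G u0 L ->
  strict_diff K u0 L.
Proof.
move=> d0 E [bL HG]; split=> // e /HG[d1 d10 Hd].
exists (Num.min d d1) => [|u v]; first by rewrite lt_min d0 d10.
by rewrite !lt_min => /andP[u1 u2] /andP[v1 v2]; rewrite -!E//; exact: Hd.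
Qed.

(** For [u] near [u0], the strict estimate between [h *: w + u] and [u] bounds the distance from the
    difference quotient to [L w] uniformly in small [h]; the bound survives the limit in [h]. *)
Lemma strict_diff_derive_cvg (V W : normedModType R) (G : V -> W) (u0 w : V) L :
  strict_diff G u0 L -> (\forall u \near u0, derivable G u w) ->
  'D_w G u @[u --> u0] --> L w.
Proof.
move=> [bL HG] dG; apply/cvgrPdist_le => e e0.
have e'0 : 0 < e / (1 + `|w|) by rewrite divr_gt0// ltr_pwDl.
have [d d0 Hd] := HG _ e'0.
near=> u.
have du : derivable G u w by near: u.
have ud : `|u - u0| < d.
  by near: u; apply/nbhs_ballP; exists d => // u; rewrite -ball_normE/= distrC.
have H : `|L w - h^-1 *: ((G \o shift u) (h *: w) - G u)| @[h --> 0^'] -->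
    `|L w - 'D_w G u|.
  by apply: cvg_norm; apply: cvgB; [exact: cvg_cst|exact: du].
apply: (cvgr_to_le H); near=> h.
have h0 : h != 0 by near: h; exact: nbhs_dnbhs_neq.
have Hh : `|(h *: w + u) - u0| < d.
  near: h; apply: nbhs_dnbhs.
  have ct : `|(h *: w + u) - u0| @[h --> (0 : R)] --> `|0 *: w + u - u0|.
    apply: cvg_norm; apply: cvgB; last exact: cvg_cst.
    apply: cvgD; last exact: cvg_cst.
    by apply: cvgZr_tmp; exact: cvg_id.
  by apply: (cvgr_lt _ ct); rewrite scale0r add0r.
have := Hd _ _ Hh ud; rewrite addrK (blinZ bL) normrZ => Hn.
rewrite -[L w]scale1r -(mulVf h0) -scalerA -scalerBr normrZ normfV.
rewrite ler_pdivrMl ?normr_gt0// -normrN opprB (le_trans Hn)//.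
rewrite mulrCA ler_wpM2l// mulrAC ler_pdivrMr ?ltr_pwDl// ler_wpM2l ?ltW//.
by rewrite ltrDr.
Unshelve. all: by end_near. Qed.

(** Injectivity persists at [(p, zeta p)], so the implicit function theorem applies again there. By
    uniqueness the new implicit function agrees with [zeta] near [p], hence [zeta] is strictly
    differentiable at [p] too. *)
Theorem implicit_function_nearby (P : normedModType R) N
    (F : P * 'rV[R]_N -> 'rV[R]_N) p0 z0 L :
  (forall u, exists M, strict_diff F u M) ->
  F (p0, z0) = 0 -> strict_diff F (p0, z0) L -> (forall w, L (0, w) = 0 -> w = 0) ->
  exists2 zeta : P -> 'rV[R]_N, zeta p0 = z0 & \forall p \near p0,
    [/\ F (p, zeta p) = 0,
        exists M, strict_diff zeta p M &
        exists2 e : R, 0 < e & forall z, `|z - zeta p| < e -> F (p, z) = 0 -> z = zeta p].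
Proof.
move=> allF F0 sF injL.
have [zeta [r [d [[r0 d0 z00] [Hz uniq [M sz]]]]]] := implicit_function F0 sF injL.
exists zeta => //.
have [d1 d10 Hinj] := nearby_injective sF injL.
have [d2 d20 Hct] := strict_diff_continuous sz d10.
apply/nbhs_ballP; exists (Num.min r (Num.min d1 d2)); first by rewrite /= !lt_min r0 d10.
move=> p; rewrite -ball_normE/= distrC !lt_min => /and3P[pr p1 p2].
have [Fp zpd] := Hz p pr.
split=> //; last first.
  exists (d - `|zeta p - z0|); first by rewrite subr_gt0.
  move=> z zz Fz; apply: uniq => //.
  rewrite -(subrK (zeta p) z) -addrA (le_lt_trans (ler_normD _ _))//.
  by rewrite -ltrBrDr.
have [L1 sF1] := allF (p, zeta p).
have pz : `|(p, zeta p) - (p0, z0)| < d1.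
  by rewrite pair_norm_lt p1 -z00 Hct.
have [zeta' [r' [d' [[r'0 d'0 z'p] [Hz' _ [M' sz']]]]]] :=
  implicit_function Fp sF1 (Hinj _ _ pz sF1).
exists M'.
have h0 : 0 < d - `|zeta p - z0| by rewrite subr_gt0.
have [d3 d30 Hct'] := strict_diff_continuous sz' h0.
have h1 : 0 < r - `|p - p0| by rewrite subr_gt0.
(* On this ball [q] stays within [r] of [p0] and [zeta' q] within [d] of [z0], the region where
   zeros are unique. *)
apply: (strict_diff_near_eq (d := Num.min r' (Num.min d3 (r - `|p - p0|))) _ _ sz').
  by rewrite !lt_min r'0 d30.
move=> q; rewrite !lt_min => /and3P[q1 q2 q3].
apply: uniq; last exact: (Hz' _ q1).1.
  by rewrite -(subrK p q) -addrA (le_lt_trans (ler_normD _ _))// -ltrBrDr.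
rewrite -(subrK (zeta p) (zeta' q)) -addrA (le_lt_trans (ler_normD _ _))//.
by rewrite -ltrBrDr -{1}z'p Hct'.
Qed.

End Nearby.

(** * Convex functions and their derivatives *)

Section Convexity.
Variable R : realType.

Lemma derive_right (V : normedModType R) (F : V -> R) y : differentiable F y -> forall v,
  s^-1 * (F (y + s *: v) - F y) @[s --> 0^'+] --> 'D_v F y.
Proof.
move=> /diff_derivable + v => /(_ v) dF.
apply: cvg_dnbhs_at_right.
have -> : (fun s : R => s^-1 * (F (y + s *: v) - F y)) =
    (fun s => s^-1 *: ((F \o shift y) (s *: v) - F y)).
  by apply/funext => s; rewrite /= (addrC y).
exact: dF.
Qed.

Lemma descent_direction (V : normedModType R) (F : V -> R) y v : differentiable F y ->
  'D_v F y < 0 -> \forall s \near 0^'+, F (y + s *: v) < F y.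
Proof.
move=> dF neg; have H := derive_right (v := v) dF.
near=> s.
have s0 : 0 < s by near: s; exact: nbhs_right_gt.
have : s^-1 * (F (y + s *: v) - F y) < 0.
  near: s; exact: (cvgr_lt _ H).
by rewrite pmulr_rlt0 ?invr_gt0// subr_lt0.
Unshelve. all: by end_near. Qed.

Lemma derive_min0 (V : normedModType R) (F : V -> R) y v : differentiable F y ->
  (forall z, F y <= F z) -> 'D_v F y = 0.
Proof.
move=> dF Fmin.
have pos w : 0 <= 'D_w F y.
  rewrite leNgt; apply/negP => /(descent_direction dF) H.
  near (0 : R)^'+ => s; have : F (y + s *: w) < F y by near: s.
  by rewrite ltNge Fmin.
have := pos (- v); rewrite !deriveE// linearN oppr_ge0 -deriveE// => neg.
by apply/eqP; rewrite eq_le neg pos.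
Unshelve. all: by end_near. Qed.

Lemma deriveB_dir (V : normedModType R) (F : V -> R) y z w : differentiable F y ->
  'D_(z - w) F y = - 'D_(w - z) F y.
Proof. by move=> dF; rewrite !deriveE// -linearN opprB. Qed.

Variable m : nat.
Implicit Types (F : 'rV[R]_m -> R) (y z v : 'rV[R]_m).

Lemma derive_grad F y v : differentiable F y ->
  'D_v F y = \sum_j v 0 j * grad F y 0 j.
Proof.
move=> dF; rewrite deriveE// {1}[v]row_sum_delta linear_sum.
by apply: eq_bigr => j _; rewrite linearZ /grad mxE deriveE.
Qed.

Lemma sqnorm_ge0 v : 0 <= sqnorm v.
Proof. by apply: sumr_ge0 => j _; rewrite sqr_ge0. Qed.

Lemma sqnormZ (a : R) v : sqnorm (a *: v) = a ^+ 2 * sqnorm v.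
Proof.
by rewrite /sqnorm mulr_sumr; apply: eq_bigr => j _; rewrite mxE exprMn.
Qed.

Lemma sqnormN v : sqnorm (- v) = sqnorm v.
Proof. by apply: eq_bigr => j _; rewrite mxE sqrrN. Qed.

(** Compares the maximum norm of row vectors with the Euclidean norm of strong convexity. *)
Lemma sqr_norm_le v : `|v| ^+ 2 <= sqnorm v.
Proof.
rewrite -[leRHS]sqr_sqrtr ?sqnorm_ge0// lerXn2r ?nnegrE// ?sqrtr_ge0//.
apply: row_norm_le => [|j]; first exact: sqrtr_ge0.
rewrite -sqrtr_sqr ler_wsqrtr// /sqnorm (bigD1 j)//= lerDl.
by apply: sumr_ge0 => i _; rewrite sqr_ge0.
Qed.

Lemma convex_strongly0 F : convex_fun F -> strongly_convex 0 F.
Proof. by move=> H y z s /H; rewrite !mul0r subr0. Qed.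

Lemma strongly_convex_convex mu F : 0 <= mu -> strongly_convex mu F -> convex_fun F.
Proof.
move=> mu0 H y z s /[dup] /andP[s0 s1] /H /le_trans; apply.
by rewrite gerBl !mulr_ge0// ?invr_ge0 ?subr_ge0 ?sqnorm_ge0.
Qed.

Lemma strongly_convex_tangent mu F y z :
  strongly_convex mu F -> differentiable F y ->
  F y + 'D_(z - y) F y + mu / 2 * sqnorm (z - y) <= F z.
Proof.
move=> cF dF.
have H := derive_right (v := z - y) dF.
have H2 : F z - F y - mu / 2 * (1 - s) * sqnorm (z - y) @[s --> 0^'+] -->
    F z - F y - mu / 2 * (1 - 0) * sqnorm (z - y).
  apply: cvgB; first exact: cvg_cst.
  apply: cvgM; last exact: cvg_cst.
  apply: cvgM; first exact: cvg_cst.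
  by apply: cvgB; [exact: cvg_cst|apply: cvg_at_right_filter; exact: cvg_id].
have : 'D_(z - y) F y <= F z - F y - mu / 2 * (1 - 0) * sqnorm (z - y).
  apply: (ler_cvg_to H H2); near=> s.
  have s0 : 0 < s by near: s; exact: nbhs_right_gt.
  have s1 : s < 1 by near: s; exact: nbhs_right_lt.
  rewrite ler_pdivrMl//.
  have := cF z y s; rewrite (ltW s0) (ltW s1) => /(_ isT).
  have -> : s *: z + (1 - s) *: y = y + s *: (z - y).
    by apply/rowP => j; rewrite !mxE; ring.
  lra.
lra.
Unshelve. all: by end_near. Qed.

Lemma convex_tangent F y z :
  convex_fun F -> differentiable F y -> F y + 'D_(z - y) F y <= F z.
Proof.
move=> /convex_strongly0/strongly_convex_tangent/[apply]/(_ z).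
by rewrite !mul0r addr0.
Qed.

Lemma strongly_convex_monotone mu F y z :
  strongly_convex mu F -> differentiable F y -> differentiable F z ->
  mu * sqnorm (z - y) <= 'D_(z - y) F z - 'D_(z - y) F y.
Proof.
move=> cF dy dz.
have := strongly_convex_tangent z cF dy.
have := strongly_convex_tangent y cF dz.
rewrite (deriveB_dir y z dz) -(sqnormN (y - z)) opprB.
lra.
Qed.

Lemma affine_line F y v (s : R) : affine_fun F ->
  F (y + s *: v) = F y + s * 'D_v F y /\ (forall z, 'D_v F z = 'D_v F y).
Proof.
move=> [c [b E]]; pose l v := \sum_j c 0 j * v 0 j.
have EF z a w : F (z + a *: w) = F z + a * l w.
  rewrite !E /l mulr_sumr addrAC -big_split/=; congr (_ + _).
  by apply: eq_bigr => j _; rewrite !mxE; ring.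
have DF z w : 'D_w F z = l w.
  apply/lim_near_cst => //; near=> h.
  have h0 : h != 0 by near: h; exact: nbhs_dnbhs_neq.
  by rewrite /= (addrC _ z) EF addrAC subrr add0r [LHS]mulrA mulVf// mul1r.
by split=> [|z]; rewrite !DF// EF.
Unshelve. all: by end_near. Qed.

Lemma affine_convex F : affine_fun F -> convex_fun F.
Proof.
move=> [c [b E]] y z s _; rewrite !E le_eqVlt; apply/orP; left; apply/eqP.
rewrite (_ : forall A B, s * (A + b) + (1 - s) * (B + b) = s * A + (1 - s) * B + b); last first.
  by move=> *; ring.
rewrite !mulr_sumr -big_split/=; congr (_ + _).
by apply: eq_bigr => j _; rewrite !mxE; ring.
Qed.

Section Joint.
Variable n : nat.
Local Notation T := ('rV[R]_n * 'rV[R]_m)%type.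
Variable G : 'rV[R]_n -> 'rV[R]_m -> R.

Lemma derive_joint_y x y v : 'D_v (G x) y = 'D_((0, v) : T) (joint G) (x, y).
Proof.
rewrite /derive; set a := (fun h : R => _); set b := (fun h : R => _).
suff -> : a = b by [].
by apply/funext => h; rewrite /a /b /joint /= scaler0 add0r.
Qed.

Lemma derive_joint_x x y (v : 'rV[R]_n) : 'D_v (G ^~ y) x = 'D_((v, 0) : T) (joint G) (x, y).
Proof.
rewrite /derive; set a := (fun h : R => _); set b := (fun h : R => _).
suff -> : a = b by [].
by apply/funext => h; rewrite /a /b /joint /= scaler0 add0r.
Qed.

Lemma differentiable_joint_y x y :
  differentiable (joint G) (x, y) -> differentiable (G x) y.
Proof.
move=> dG; have -> : G x = joint G \o (fun y => (x, y)) by [].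
by apply: differentiable_comp => //; apply: differentiable_pair.
Qed.

(* The right-hand side is the Hessian quadratic form of [G x] at [y] in direction [d]. *)
Lemma hessian_strongly_convex mu x y d : C2 (joint G) -> strongly_convex mu (G x) ->
  mu * sqnorm d <=
  \sum_j d 0 j * 'D_((0, d) : T) (fun p => 'D_((0, evec R j) : T) (joint G) p) (x, y).
Proof.
move=> [[dG _] c2] cG.
have dGy z : differentiable (G x) z by exact: differentiable_joint_y.
(* The Hessian form is the limit of difference quotients of the gradient paired with [d];
   monotonicity of the gradient bounds each of them below by [mu * sqnorm d]. *)
have H : \sum_j d 0 j * (s^-1 * ('D_((0, evec R j) : T) (joint G) ((x, y) + s *: ((0, d) : T)) -
    'D_((0, evec R j) : T) (joint G) (x, y))) @[s --> 0^'+] -->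
    \sum_j d 0 j * 'D_((0, d) : T) (fun p => 'D_((0, evec R j) : T) (joint G) p) (x, y).
  apply: cvg_big => //; first exact: add_continuous.
  move=> j _; apply: cvgM; first exact: cvg_cst.
  exact: (derive_right (v := (0, d) : T) ((c2 ((0, evec R j) : T)).1 (x, y))).
apply: (cvgr_to_ge H); near=> s.
have s0 : 0 < s by near: s; exact: nbhs_right_gt.
have := strongly_convex_monotone cG (dGy y) (dGy (y + s *: d)).
rewrite [y + _]addrC addrK sqnormZ !derive_grad// -sumrB.
rewrite (_ : \sum__ _ = s ^+ 2 * \sum_j d 0 j * (s^-1 * ('D_((0, evec R j) : T) (joint G) ((x, y) + s *: ((0, d) : T)) -
    'D_((0, evec R j) : T) (joint G) (x, y)))).
  by rewrite mulrCA ler_pM2l// exprn_gt0.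
rewrite mulr_sumr; apply: eq_bigr => j _; rewrite !mxE !derive_joint_y.
have -> : (x, y) + s *: ((0, d) : T) = (x, s *: d + y).
  by congr pair; rewrite /= ?scaler0 ?addr0// addrC.
by field; rewrite gt_eqF.
Unshelve. all: by end_near. Qed.

End Joint.
End Convexity.

(** * The lower-level problem and its barrier version *)

Section LowerLevel.
Variables (R : realType) (n m k : nat).
Variables (g : 'rV[R]_n -> 'rV[R]_m -> R) (h : 'I_k -> 'rV[R]_n -> 'rV[R]_m -> R).
Variable x : 'rV[R]_n.
Hypothesis dg : forall y, differentiable (g x) y.
Hypothesis dh : forall i y, differentiable (h i x) y.

Lemma closed_feas : closed (feas h x).
Proof.
have -> : feas h x = \bigcap_(i in [set: 'I_k]) [set y | h i x y <= 0].
  by apply/seteqP; split=> y /=; [move=> H i _; exact: H|move=> H i; exact: H].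
apply: closed_bigI => i _.
have -> : [set y | h i x y <= 0] = h i x @^-1` [set r | r <= 0] by [].
apply: closed_comp; last exact: closed_le.
by move=> y _; exact: differentiable_continuous.
Qed.

Lemma ll_sol_compact : feas h x !=set0 -> compact (feas h x) -> ll_sol g h x !=set0.
Proof.
move=> f0 fc; have [|y yf ymin] := EVT_min_rV f0 fc (f := g x).
  by apply: continuous_subspaceT => y; exact: differentiable_continuous.
exists y; split; first by rewrite inE in yf.
by move=> z zf; apply: ymin; rewrite inE.
Qed.

(** The feasible points with value at most [g x y0] form a compact set: the tangent inequality at
    [y0] gives [mu / 2 * |z - y0|^2 <= C * |z - y0|], so they lie within [2 * C / mu] of [y0]. *)
Lemma ll_sol_strongly_convex mu : 0 < mu -> strongly_convex mu (g x) ->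
  feas h x !=set0 -> ll_sol g h x !=set0.
Proof.
move=> mu0 cg [y0 fy0].
pose K := feas h x `&` [set z | g x z <= g x y0].
have [C C0 HC] := linear_lipschitz (diff_continuous (dg y0)).
have cK : compact K.
  apply: bounded_closed_compact.
    exists (2 * C / mu + `|y0|); split; first exact: num_real.
    move=> M HM z [_ /= zy0].
    have := strongly_convex_tangent z cg (dg y0).
    have := HC (z - y0); rewrite -deriveE// ler_norml => /andP[H1 _] H2.
    have H3 : `|z - y0| <= 2 * C / mu.
      have [->|zN0] := eqVneq (z - y0) 0; first by rewrite normr0 !mulr_ge0 ?invr_ge0 ?ltW.
      have nz : 0 < `|z - y0| by rewrite normr_gt0.
      have H4 : mu / 2 * `|z - y0| ^+ 2 <= C * `|z - y0|.
        have := sqr_norm_le (z - y0) => H4.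
        have : mu / 2 * `|z - y0| ^+ 2 <= mu / 2 * sqnorm (z - y0).
          by rewrite ler_wpM2l// divr_ge0// ltW.
        lra.
      move: H4; rewrite expr2 mulrA ler_pM2r// => H4.
      by rewrite ler_pdivlMr//; lra.
    rewrite -(subrK y0 z) (le_trans (ler_normD _ _))// ltW// (le_lt_trans _ HM)//.
    by rewrite lerD2r.
  apply: closedI; first exact: closed_feas.
  have -> : [set z | g x z <= g x y0] = g x @^-1` [set r | r <= g x y0] by [].
  apply: closed_comp; last exact: closed_le.
  by move=> y _; exact: differentiable_continuous.
have K0 : K !=set0 by exists y0; split=> //=; exact: lexx.
have [|y yK ymin] := EVT_min_rV K0 cK (f := g x).
  by apply: continuous_subspaceT => y; exact: differentiable_continuous.
move: yK; rewrite inE => -[yf yy0]; exists y; split => // z zf.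
have [zy0|/ltW zy0] := leP (g x z) (g x y0); first by apply: ymin; rewrite inE.
exact: le_trans zy0.
Qed.

(** A short step along [d] stays feasible, because active constraints decrease and inactive ones
    remain negative by continuity; it would lower the objective. *)
Lemma ll_sol_no_descent y d : ll_sol g h x y ->
  (forall i, h i x y = 0 -> 'D_d (h i x) y < 0) -> 'D_d (g x) y < 0 -> False.
Proof.
move=> [yf ymin] Hh Hg.
have Hi i : \forall s \near 0^'+, h i x (y + s *: d) <= 0.
  have [/Hh H|hN0] := eqVneq (h i x y) 0.
    have := descent_direction (dh i y) H; apply: filterS => s /ltW /le_trans; apply.
    exact: yf.
  have neg : h i x y < 0 by rewrite lt_neqAle hN0 yf.
  have ct : h i x (y + s *: d) @[s --> 0^'+] --> h i x y.
    have H0 : (y + s *: d) @[s --> 0^'+] --> y.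
      rewrite -[X in _ --> X]addr0 -(scale0r d); apply: cvgD; first exact: cvg_cst.
      by apply: cvgZr_tmp; apply: cvg_at_right_filter; exact: cvg_id.
    apply: (cvg_comp _ _ H0); exact: (differentiable_continuous (dh i y)).
  by near=> s; apply: ltW; near: s; exact: (cvgr_lt _ ct).
have Hall : \forall s \near 0^'+, forall i, h i x (y + s *: d) <= 0 by exact: filter_forall.
have Hd := descent_direction (dg y) Hg.
near (0 : R)^'+ => s.
have : g x (y + s *: d) < g x y by near: s.
rewrite ltNge => /negP; apply; apply: ymin => i; move: i; near: s; exact: Hall.
Unshelve. all: by end_near. Qed.

(** LICQ gives a right inverse of the constraint matrix, so the derivatives of the active
    constraints can be prescribed at will. Whenever the objective gradient is not a combination of
    active gradients with nonpositive coefficients, this freedom produces a descent direction that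
    [ll_sol_no_descent] excludes. *)
Lemma KKT_mult_exists y : ll_sol g h x y ->
  (forall c : 'I_k -> R, (forall i, h i x y <> 0 -> c i = 0) ->
      \sum_(i < k) c i *: grad_y (h i) x y = 0 -> forall i, c i = 0) ->
  exists lam, KKT_mult g h x y lam.
Proof.
move=> ysol licq.
pose act i := h i x y == 0.
(* Rows of active constraints carry their gradient, the others an extra unit
   vector: this makes LICQ the row-freeness of a single matrix. *)
pose M : 'M[R]_(k, m + k) := row_mx
  (\matrix_(i, j) if act i then grad_y (h i) x y 0 j else 0)
  (\matrix_(i, j) if (i == j) && ~~ act i then 1 else 0).
pose G : 'rV[R]_(m + k) := row_mx (grad_y g x y) 0.
have inact_col (D : 'rV[R]_k) i : ~~ act i -> (D *m rsubmx M) 0 i = D 0 i.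
  move=> ai; rewrite mxE (bigD1 i)//= big1 => [|j ji].
    by rewrite row_mxKr mxE eqxx ai mulr1 addr0.
  by rewrite row_mxKr mxE (negbTE ji) mulr0.
have act_sum (D : 'rV[R]_k) : (forall i, ~~ act i -> D 0 i = 0) ->
    D *m lsubmx M = \sum_i D 0 i *: grad_y (h i) x y.
  move=> HD; apply/rowP => j; rewrite mxE summxE; apply: eq_bigr => i _.
  rewrite row_mxKl !mxE; case: ifP => [//|/negbT ai].
  by rewrite HD// !mul0r.
have freeM : row_free M.
  apply: inj_row_free => D DM.
  have [Dl Dr] : D *m lsubmx M = 0 /\ D *m rsubmx M = 0.
    move: DM; rewrite -{1}(hsubmxK M) mul_mx_row -(row_mx0 _ 1 m k) => /eq_row_mx.
    by [].
  have Din i : ~~ act i -> D 0 i = 0 by move=> ai; rewrite -inact_col// Dr mxE.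
  apply/rowP => i; rewrite mxE; apply: (licq (fun i => D 0 i)).
    by move=> j /eqP; exact: Din.
  by rewrite -act_sum.
have dirs (dd : 'cV[R]_(m + k)) : let d := (usubmx dd)^T in
    (forall i, act i -> 'D_d (h i x) y = (M *m dd) i 0) /\
    'D_d (g x) y = (G *m dd) 0 0.
  move=> d; split=> [i ai|].
    rewrite -(vsubmxK dd) mul_row_col !mxE [X in _ + X]big1 => [|j _].
      by rewrite addr0 derive_grad//; apply: eq_bigr => j _; rewrite !mxE ai mulrC.
    by rewrite !mxE ai andbF mul0r.
  rewrite -(vsubmxK dd) mul_row_col mul0mx addr0 derive_grad// mxE.
  by apply: eq_bigr => j _; rewrite !mxE mulrC.
have nodir (dd : 'cV[R]_(m + k)) :
    (forall i, act i -> (M *m dd) i 0 < 0) -> (G *m dd) 0 0 < 0 -> False.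
  move=> H1 H2; have [H3 H4] := dirs dd.
  apply: (@ll_sol_no_descent y (usubmx dd)^T ysol); last by rewrite H4.
  by move=> i /eqP ai; rewrite H3// H1.
have MN : M *m pinvmx M = 1%:M by exact: mulmxVp.
set N := pinvmx M in MN.
have [/submxP[D GD]|GM] := boolP (G <= M)%MS; last first.
  (* A column of the cokernel is killed by [M] but not by [G]. Adding a multiple of it to [w] leaves
     all active derivatives at -1 and tunes the derivative of the objective to -1. *)
  exfalso; move: GM; rewrite submxE => /rV0Pn[j]; set q := _ 0 j => q0.
  pose w : 'cV[R]_(m + k) := N *m const_mx (-1); pose S := (G *m w) 0 0.
  pose dd : 'cV[R]_(m + k) := (- (1 + S) / q) *: col j (cokermx M) + w.
  apply: (nodir dd) => [i _|]; rewrite /dd mulmxDr -scalemxAr colE (mulmxA _ (cokermx M)).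
    by rewrite mulmx_coker mul0mx /w mulmxA MN mul1mx !mxE mulr0 add0r ltrN10.
  rewrite -colE mxE -/S [X in X + _]mxE [X in _ * X + _]mxE -/q divfK//.
  lra.
have [Gl Gr] : D *m lsubmx M = grad_y g x y /\ D *m rsubmx M = 0.
  move: GD; rewrite -{1}(hsubmxK M) mul_mx_row => /eq_row_mx.
  by case.
have Din i : ~~ act i -> D 0 i = 0 by move=> ai; rewrite -inact_col// Gr mxE.
exists (fun i => - D 0 i); split; last split.
- move=> j; rewrite oppr_ge0 leNgt; apply/negP => Dj.
  (* The direction [N *m c] gives the active constraints derivatives [c i < 0] and the objective the
     derivative [- D 0 j - e * S], negative because [e * |S| < D 0 j]. *)
  pose S := \sum_i D 0 i; pose e := D 0 j / (1 + `|S|).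
  have S1 : 0 < 1 + `|S| by rewrite ltr_pwDl.
  have e0 : 0 < e by rewrite divr_gt0.
  pose c : 'cV[R]_k := \col_i (- (i == j)%:R - e).
  apply: (nodir (N *m c)).
    move=> i _; rewrite mulmxA MN mul1mx mxE.
    by rewrite subr_lt0 (le_lt_trans _ e0)// oppr_le0 ler0n.
  rewrite GD -mulmxA (mulmxA M) MN mul1mx mxE.
  rewrite (_ : \sum__ _ = - D 0 j - e * S); last first.
    rewrite /S mulr_sumr -sumrN (bigD1 j)//= [in RHS](bigD1 j)//= !mxE eqxx mulr1n.
    rewrite [X in _ + X = _](eq_bigr (fun i => - (e * D 0 i))); last first.
      by move=> i ij; rewrite mxE (negbTE ij) mulr0n; ring.
    ring.
  have : - S <= `|S| by rewrite lerNl; have := ler_norm (- S); rewrite normrN; lra.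
  have : e * (1 + `|S|) = D 0 j by rewrite divfK// gt_eqF.
  nra.
- move=> i; have [/eqP->|/Din->] := boolP (act i); first by rewrite mulr0.
  by rewrite oppr0 mul0r.
- rewrite -Gl act_sum// -big_split/= big1// => i _.
  by rewrite scaleNr subrr.
Qed.

End LowerLevel.

(** * Nondegeneracy of linear programs, and uniqueness of lower-level and barrier solutions *)

Section Uniqueness.
Variables (R : realType) (n m k : nat).
Variables (g : 'rV[R]_n -> 'rV[R]_m -> R) (h : 'I_k -> 'rV[R]_n -> 'rV[R]_m -> R).
Variable x : 'rV[R]_n.
Hypothesis dg : forall y, differentiable (g x) y.
Hypothesis dh : forall i y, differentiable (h i x) y.

(** In other words, the active gradients span the space: the solution is a vertex. SCSC is used at
    the second solution [y'], where [lam] is still a multiplier. *)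
Lemma linear_program_active_span y lam d :
  affine_fun (g x) -> (forall i, affine_fun (h i x)) -> compact (feas h x) ->
  SCSC g h x -> ll_sol g h x y -> KKT_mult g h x y lam ->
  (forall i, h i x y = 0 -> 'D_d (h i x) y = 0) -> d = 0.
Proof.
move=> ag ah cf scsc ysol [lam0 [cs stat]] Hact.
have [yf ymin] := ysol.
apply/eqP/negPn/negP => d0.
pose al i := 'D_d (h i x) y.
have hl i s : h i x (y + s *: d) = h i x y + s * al i.
  exact: (affine_line y d s (ah i)).1.
have [M [_ HM]] := compact_bounded cf.
have nd : 0 < `|d| by rewrite normr_gt0.
(* So long a step from [y] leaves the ball of radius [|M| + 1], which contains the feasible set;
   hence some constraint increases along [d]. *)
pose s0 := (`|M| + 1 + `|y| + 1) / `|d|.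
have s00 : 0 <= s0 by rewrite divr_ge0// !addr_ge0.
have [i0 ali0] : exists i, 0 < al i.
  apply: contrapT => H.
  have fs : feas h x (y + s0 *: d).
    move=> i; rewrite hl; have : al i <= 0.
      by rewrite leNgt; apply/negP => a0; apply: H; exists i.
    have := yf i; nra.
  have M1 : M < `|M| + 1 by rewrite (le_lt_trans (ler_norm M))// ltrDl.
  have := HM _ M1 _ fs => /=.
  have : `|s0 *: d| = `|M| + 1 + `|y| + 1 by rewrite normrZ ger0_norm// divfK// gt_eqF.
  have := ler_normB (y + s0 *: d) y; rewrite [X in `|X - y|]addrC addrK.
  lra.
(* The ratio test: [r i] is the step at which constraint [i] becomes active, and the least one is
   attained at [j]. *)
pose r i := - h i x y / al i.
case: (@arg_minP _ _ _ i0 (fun i => 0 < al i) r ali0) => j alj jmin.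
have rj : 0 <= r j by rewrite divr_ge0 ?oppr_ge0 ?yf// ltW.
pose y' := y + r j *: d.
have hj : h j x y' = 0 by rewrite hl /r mulrAC mulfK ?gt_eqF// addrN.
have f' : feas h x y'.
  move=> i; rewrite hl; have [al0|al0] := ltP 0 (al i).
    have := jmin i al0; rewrite {2}/r ler_pdivlMr//; lra.
  have := yf i; nra.
have inactj : h j x y != 0.
  by apply/eqP => /Hact aj; move: alj; rewrite /al aj ltxx.
have lamj : lam j = 0.
  by have /eqP := cs j; rewrite mulf_eq0 (negbTE inactj) orbF => /eqP.
have lamal i : lam i * al i = 0.
  have /eqP := cs i; rewrite mulf_eq0 => /orP[/eqP->|/eqP /Hact]; first by rewrite mul0r.
  by rewrite /al => ->; rewrite mulr0.
(* Pair the stationarity equation with [d]: every constraint term vanishes. *)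
have Dg : 'D_d (g x) y = 0.
  have : \sum_j0 d 0 j0 * (grad_y g x y + \sum_(i < k) lam i *: grad_y (h i) x y) 0 j0 = 0.
    by rewrite big1// => j0 _; rewrite stat mxE mulr0.
  have -> : \sum_j0 d 0 j0 * (grad_y g x y + \sum_(i < k) lam i *: grad_y (h i) x y) 0 j0 =
      'D_d (g x) y + \sum_i lam i * al i.
    have -> : \sum_i lam i * al i = \sum_i \sum_j0 lam i * (d 0 j0 * grad (h i x) y 0 j0).
      by apply: eq_bigr => i _; rewrite /al derive_grad// mulr_sumr.
    rewrite derive_grad// exchange_big/= -big_split/=; apply: eq_bigr => j0 _.
    rewrite mxE summxE mulrDr mulr_sumr; congr (_ + _).
    by apply: eq_bigr => i _; rewrite mxE mulrCA.
  by rewrite (eq_bigr (fun=> 0)) ?big1 ?addr0.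
have g' : g x y' = g x y by rewrite (affine_line y d (r j) ag).1 Dg mulr0 addr0.
have sol' : ll_sol g h x y' by split=> // z zf; rewrite g'; exact: ymin.
have kkt' : KKT_mult g h x y' lam.
  split; [exact: lam0|split=> [i|]].
    by rewrite hl mulrDr cs add0r mulrCA lamal mulr0.
  rewrite -[RHS]stat; congr (_ + _).
    by apply/rowP => q; rewrite !mxE (affine_line y _ 0 ag).2.
  apply: eq_bigr => i _; congr (_ *: _).
  by apply/rowP => q; rewrite !mxE (affine_line y _ 0 (ah i)).2.
by have := scsc y' sol' lam kkt' j hj; rewrite lamj ltxx.
Qed.

Hypothesis cg : convex_fun (g x).
Hypothesis ch : forall i, convex_fun (h i x).

(* Zeros of the perturbed KKT system for a fixed multiplier; [t = 0] is the
   lower-level problem and [t > 0] its barrier version. *)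
Definition perturbed_KKT (lam : 'I_k -> R) (t : R) y :=
  grad_y g x y + \sum_i lam i *: grad_y (h i) x y = 0 /\
  forall i, lam i * h i x y = - t.

Variables (lam : 'I_k -> R) (t : R) (y : 'rV[R]_m).
Hypothesis lam0 : forall i, 0 <= lam i.
Hypothesis Hy : perturbed_KKT lam t y.
Hypothesis loc_uniq : exists2 e : R, 0 < e & forall z, `|z - y| < e ->
  perturbed_KKT lam t z -> z = y.

Let lagr z := g x z + \sum_i lam i * h i x z.

Let dsum z : differentiable (fun z => \sum_i lam i * h i x z) z /\
  forall v, 'D_v (fun z => \sum_i lam i * h i x z) z = \sum_i lam i * 'D_v (h i x) z.
Proof.
have -> : (fun z => \sum_i lam i * h i x z) = \sum_i (lam i *: h i x).
  by apply/funext => w; rewrite fct_sumE.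
have dl i : differentiable (lam i *: h i x) z by exact: differentiableZ.
split=> [|v]; first exact: differentiable_sum.
rewrite derive_sum => [|i]; last exact: diff_derivable.
by apply: eq_bigr => i _; rewrite deriveZ//; exact: diff_derivable.
Qed.

Let dlagr z : differentiable lagr z.
Proof. exact: (differentiableD (dg z) (dsum z).1). Qed.

Let derive_lagr z v : 'D_v lagr z = 'D_v (g x) z + \sum_i lam i * 'D_v (h i x) z.
Proof.
rewrite -(dsum z).2; apply: deriveD; apply: diff_derivable => //.
exact: (dsum z).1.
Qed.

Let grad_lagr z : grad lagr z = grad_y g x z + \sum_i lam i *: grad_y (h i) x z.
Proof.
apply/rowP => j; rewrite !mxE derive_lagr summxE; congr (_ + _).
by apply: eq_bigr => i _; rewrite !mxE.
Qed.

Let lagr_convex : convex_fun lagr.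
Proof.
move=> u v s sI; rewrite /lagr !mulrDr addrACA lerD ?cg//.
rewrite !mulr_sumr -big_split/=; apply: ler_sum => i _.
have -> : s * (lam i * h i x u) + (1 - s) * (lam i * h i x v) =
  lam i * (s * h i x u + (1 - s) * h i x v) by ring.
by rewrite ler_wpM2l//; exact: ch.
Qed.

Let lagr_min z : lagr y <= lagr z.
Proof.
have := convex_tangent z lagr_convex (dlagr y).
rewrite derive_grad// grad_lagr Hy.1 big1 ?addr0// => j _.
by rewrite [X in _ * X]mxE mulr0.
Qed.

Let lagr_stat z : lagr z <= lagr y -> grad_y g x z + \sum_i lam i *: grad_y (h i) x z = 0.
Proof.
move=> zy; rewrite -grad_lagr; apply/rowP => j; rewrite !mxE.
by apply: (derive_min0 _ (dlagr z)) => w; exact: le_trans zy (lagr_min w).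
Qed.

(** Local uniqueness becomes global on a set star-shaped about [y]: any [z] in it can be pulled
    along the segment into the neighbourhood, where the pulled point must equal [y]. *)
Let segment_unique (S : set 'rV[R]_m) :
  (forall z, S z -> perturbed_KKT lam t z) ->
  (forall z s, S z -> 0 <= s <= 1 -> S (s *: z + (1 - s) *: y)) ->
  forall z, S z -> z = y.
Proof.
move=> S1 S2 z Sz; have [e e0 He] := loc_uniq.
pose s := Num.min 1 (e / (2 * (1 + `|z - y|))).
have N0 : 0 < 1 + `|z - y| by rewrite ltr_pwDl.
have s0 : 0 < s by rewrite lt_min ltr01 divr_gt0// mulr_gt0.
have s1 : s <= 1 by rewrite ge_min lexx.
have sI : 0 <= s <= 1 by rewrite (ltW s0).
have E : s *: z + (1 - s) *: y - y = s *: (z - y).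
  by apply/rowP => j; rewrite !mxE; ring.
have := He _ _ (S1 _ (S2 _ _ Sz sI)); rewrite E => /(_ _)/wrap[].
  rewrite normrZ gtr0_norm//.
  have : s <= e / (2 * (1 + `|z - y|)) by rewrite ge_min lexx orbT.
  rewrite ler_pdivlMr ?mulr_gt0//; have := normr_ge0 (z - y); nra.
move=> /eqP; rewrite -subr_eq0 E scaler_eq0 gt_eqF//= subr_eq0 => /eqP.
by [].
Qed.

(** The Lagrangian bounds [g] from below on the feasible set and is minimal at [y], with equal
    value. Another solution also minimizes it with vanishing complementarity products, so it
    satisfies the same system; the solution set is convex, and [segment_unique] concludes. *)
Lemma ll_sol_unique : t = 0 -> feas h x y -> unique_elt (ll_sol g h x) y.
Proof.
move=> t0 yf.
have cs i : lam i * h i x y = 0 by rewrite Hy.2 t0 oppr0.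
have Ly : lagr y = g x y by rewrite /lagr big1 ?addr0.
have gz z : feas h x z -> lagr z <= g x z.
  move=> zf; rewrite gerDl; apply: sumr_le0 => i _.
  by rewrite mulr_ge0_le0.
have ysol : ll_sol g h x y.
  by split=> // z zf; rewrite -Ly (le_trans (lagr_min z))// gz.
split=> //; apply: segment_unique => z; last first.
  move=> s [zf zmin] sI; have zsf : feas h x (s *: z + (1 - s) *: y).
    move=> i; rewrite (le_trans (ch _ _ _ sI))//; have /andP[s0 s1] := sI.
    have := zf i; have := yf i; nra.
  split=> // w wf; apply: le_trans (cg _ _ sI) _.
  have := zmin _ yf; have := ysol.2 _ zf; have := zmin _ wf.
  have /andP[s0 s1] := sI; nra.
move=> [zf zmin]; have zy := zmin _ yf.
split; first by apply: lagr_stat; rewrite (le_trans (gz _ zf))// Ly.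
have S0 : \sum_i (- (lam i * h i x z)) <= 0.
  by have := lagr_min z; rewrite Ly {1}/lagr sumrN; lra.
move=> i; rewrite t0 oppr0; apply/oppr_inj; rewrite oppr0.
have pos j : true -> 0 <= - (lam j * h j x z) by rewrite oppr_ge0 mulr_ge0_le0.
apply: (psumr_eq0P pos) => //; apply/eqP; rewrite eq_le S0/=.
exact: sumr_ge0.
Qed.

(** The logarithm lies below its tangent at [a] and touches it only there; the equality case will
    identify constraint values. *)
Let ln_tangent (a b : R) : 0 < a -> 0 < b -> ln b - ln a <= b / a - 1 /\
  (ln b - ln a = b / a - 1 -> b = a).
Proof.
move=> a0 b0; rewrite -ln_div//; set q := b / a.
have q0 : 0 < q by rewrite divr_gt0.
have E : expR (ln q) = q by rewrite lnK.
split; first by have := expR_ge1Dx (ln q); rewrite E; lra.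
have [l0 _|/expR_gt1Dx] := eqVneq (ln q) 0; last by rewrite E; lra.
by move: E; rewrite l0 expR0 => /esym/divr1_eq.
Qed.

Lemma barrier_sol_unique : 0 < t -> sfeas h x y -> unique_elt (barrier_sol g h t x) y.
Proof.
move=> t0 yf.
have N0 z i : sfeas h x z -> 0 < - h i x z by move=> zf; rewrite oppr_gt0.
have lamE i : lam i = t / - h i x y.
  have -> : t = - (lam i * h i x y) by rewrite Hy.2 opprK.
  by field; rewrite lt_eqF ?yf.
(* [slack i z] is [t] times the gap in the tangent inequality for the logarithm. The barrier gap
   then splits into a Lagrangian gap and these slacks, all nonnegative; at another minimizer each is
   zero, so it has the same constraint values as [y]. *)
pose slack i z := t * (- h i x z / - h i x y - 1 - (ln (- h i x z) - ln (- h i x y))).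
have slack0 i z : sfeas h x z -> 0 <= slack i z.
  move=> zf; apply: mulr_ge0; first exact: ltW.
  by rewrite subr_ge0; exact: (ln_tangent (N0 _ _ yf) (N0 _ _ zf)).1.
have barE z : gbar g h t x z - gbar g h t x y = (lagr z - lagr y) + \sum_i slack i z.
  have slE i : slack i z = - (lam i * h i x z) + lam i * h i x y -
      t * ln (- h i x z) + t * ln (- h i x y).
    by rewrite /slack lamE; field; rewrite lt_eqF ?yf.
  rewrite /gbar /lagr (eq_bigr _ (fun i _ => slE i)) !big_split/= !sumrN -!mulr_sumr.
  ring.
have ysol : barrier_sol g h t x y.
  split=> // z zf; rewrite -subr_ge0 barE addr_ge0// ?subr_ge0//.
  by apply: sumr_ge0 => i _; exact: slack0.
have eqs z : barrier_sol g h t x z -> lagr z <= lagr y /\ forall i, h i x z = h i x y.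
  move=> [zf /(_ y yf)]; rewrite -subr_le0 barE => H.
  have S0 : 0 <= \sum_i slack i z by apply: sumr_ge0 => i _; exact: slack0.
  have L0 := lagr_min z.
  split; first lra.
  move=> i; have : slack i z = 0.
    have pos j : true -> 0 <= slack j z by move=> _; exact: slack0.
    by apply: (psumr_eq0P pos) => //; lra.
  move=> /eqP; rewrite mulf_eq0 gt_eqF//= subr_eq0 eq_sym => /eqP.
  by move=> /(ln_tangent (N0 _ _ yf) (N0 _ _ zf)).2/oppr_inj.
split=> //; apply: segment_unique => z.
  move=> zsol; have [Lz hz] := eqs z zsol; split; first exact: lagr_stat.
  by move=> i; rewrite hz Hy.2.
move=> s zsol sI; have [Lz hz] := eqs z zsol; have /andP[s0 s1] := sI.
have gz : g x z <= g x y.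
  by move: Lz; rewrite /lagr (eq_bigr (fun i => lam i * h i x y)) ?lerD2r// => i _; rewrite hz.
have hs i : h i x (s *: z + (1 - s) *: y) <= h i x y.
  by rewrite (le_trans (ch _ _ _ sI))// hz -mulrDl addrC subrK mul1r.
have sf : sfeas h x (s *: z + (1 - s) *: y).
  by move=> i; rewrite (le_lt_trans (hs i)).
split=> // w wf; apply: le_trans (ysol.2 w wf).
rewrite /gbar lerB//; first by rewrite (le_trans (cg _ _ sI))//; nra.
rewrite ler_pM2l//; apply: ler_sum => i _.
by rewrite ler_ln ?posrE ?N0// lerN2.
Qed.

End Uniqueness.

(** * The primal-dual system *)

Section KKTMap.
Variables (R : realType) (n m k : nat).
Variables (g : 'rV[R]_n -> 'rV[R]_m -> R) (h : 'I_k -> 'rV[R]_n -> 'rV[R]_m -> R).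
Hypothesis Cg : C2 (joint g).
Hypothesis Ch : forall i, C2 (joint (h i)).
Local Notation T := ('rV[R]_n * 'rV[R]_m)%type.
Local Notation E j := ((0, evec R j) : T).

(** The parameter is [(x, t)]; the point [y] and the multipliers are packed into one row, which
    makes the system square in the unknown. *)
Definition kkt_map (u : ('rV[R]_n * R) * 'rV[R]_(m + k)) : 'rV[R]_(m + k) :=
  let x := u.1.1 in let y := lsubmx u.2 in let lam i := u.2 0 (rshift m i) in
  row_mx (grad_y g x y + \sum_i lam i *: grad_y (h i) x y)
         (\row_i (lam i * h i x y + u.1.2)).

Definition kkt_diff (u v : ('rV[R]_n * R) * 'rV[R]_(m + k)) : 'rV[R]_(m + k) :=
  let p := (u.1.1, lsubmx u.2) : T in let w := (v.1.1, lsubmx v.2) : T in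
  let lam i := u.2 0 (rshift m i) in let mu i := v.2 0 (rshift m i) in
  row_mx (\row_j ('D_w (fun p => 'D_(E j) (joint g) p) p +
     \sum_i (mu i * 'D_(E j) (joint (h i)) p +
             lam i * 'D_w (fun p => 'D_(E j) (joint (h i)) p) p)))
   (\row_i (mu i * joint (h i) p + lam i * 'D_w (joint (h i)) p + v.1.2)).

Lemma blin_lsubmx : bounded_linear (fun v : 'rV[R]_(m + k) => lsubmx v).
Proof.
apply: blin_row => j; have -> : (fun v : 'rV[R]_(m + k) => lsubmx v 0 j : R) =
  (fun v => v 0 (lshift k j)) by apply/funext => v; rewrite mxE.
exact: blin_entry.
Qed.

Lemma kkt_map0P x t y lam :
  kkt_map ((x, t), row_mx y lam) = 0 <-> perturbed_KKT g h x (fun i => lam 0 i) t y.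
Proof.
rewrite /kkt_map /= row_mxKl; split.
  rewrite -(row_mx0 _ 1 m k) => /eq_row_mx[H1 H2]; split.
    by rewrite -[RHS]H1; congr (_ + _); apply: eq_bigr => i _; rewrite row_mxEr.
  move=> i; move/rowP/(_ i): H2; rewrite mxE row_mxEr [X in _ = X]mxE => /eqP.
  by rewrite addr_eq0 => /eqP.
move=> [H1 H2]; rewrite -(row_mx0 _ 1 m k); congr row_mx.
  by rewrite -[RHS]H1; congr (_ + _); apply: eq_bigr => i _; rewrite row_mxEr.
by apply/rowP => i; rewrite mxE row_mxEr H2 addNr mxE.
Qed.

(** Each component is built by sums and products from linear projections and [C1] functions of
    [(x, y)]; the gradient entries are [C1] because [g] and [h] are [C2]. *)
Lemma strict_diff_kkt u : strict_diff kkt_map u (kkt_diff u).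
Proof.
pose pr (u : ('rV[R]_n * R) * 'rV[R]_(m + k)) : T := (u.1.1, lsubmx u.2).
have bpr : bounded_linear pr.
  apply: blin_pair; last exact: (blin_comp (blin_snd _ _) blin_lsubmx).
  exact: (blin_comp (blin_fst _ _) (blin_fst _ _)).
have spr := strict_diff_blin u bpr.
have bl i : bounded_linear (fun u : ('rV[R]_n * R) * 'rV[R]_(m + k) => u.2 0 (rshift m i) : R).
  apply: (@blin_comp R _ _ _ (fun u => u.2) (fun v : 'rV[R]_(m + k) => v 0 (rshift m i) : R)).
    exact: blin_snd.
  exact: blin_entry.
have sl i := strict_diff_blin u (bl i).
have st := strict_diff_blin u (@blin_comp R _ _ _ _ _ (blin_fst ('rV[R]_n * R)%type 'rV[R]_(m + k)) (blin_snd _ _)).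
have sC (G : T -> R) : C1 G -> strict_diff (fun u => G (pr u)) u (fun v => 'D_(pr v) G (pr u)).
  by move=> cG; exact: (strict_diff_comp spr (C1_strict_diff (pr u) cG)).
apply: strict_diff_row => j; case: (split_ordP j) => i ->.
  have -> : (fun u => kkt_map u 0 (lshift k i)) = (fun u =>
      'D_(E i) (joint g) (pr u) + \sum_l u.2 0 (rshift m l) * 'D_(E i) (joint (h l)) (pr u)).
    apply/funext => v; rewrite /kkt_map row_mxEl mxE summxE mxE derive_joint_y.
    by congr (_ + _); apply: eq_bigr => l _; rewrite !mxE derive_joint_y.
  have -> : (fun v => kkt_diff u v 0 (lshift k i)) = (fun v =>
      'D_(pr v) (fun p => 'D_(E i) (joint g) p) (pr u) +
      \sum_l (v.2 0 (rshift m l) * 'D_(E i) (joint (h l)) (pr u) +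
        u.2 0 (rshift m l) * 'D_(pr v) (fun p => 'D_(E i) (joint (h l)) p) (pr u))).
    by apply/funext => v; rewrite /kkt_diff row_mxEl mxE.
  apply: strict_diff_add; first by apply: sC; exact: (Cg.2 _).
  apply: strict_diff_sum => l; apply: strict_diff_mul; first exact: sl.
  by apply: sC; exact: ((Ch l).2 _).
have -> : (fun u => kkt_map u 0 (rshift m i)) = (fun u =>
    u.2 0 (rshift m i) * joint (h i) (pr u) + u.1.2).
  by apply/funext => v; rewrite /kkt_map row_mxEr mxE.
have -> : (fun v => kkt_diff u v 0 (rshift m i)) = (fun v =>
    v.2 0 (rshift m i) * joint (h i) (pr u) +
    u.2 0 (rshift m i) * 'D_(pr v) (joint (h i)) (pr u) + v.1.2).
  by apply/funext => v; rewrite /kkt_diff row_mxEr mxE.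
apply: strict_diff_add => //; apply: strict_diff_mul; first exact: sl.
by apply: sC; exact: (Ch i).1.
Qed.

Let dgy x y : differentiable (g x) y.
Proof. by apply: differentiable_joint_y; exact: Cg.1.1. Qed.

Let dhy i x y : differentiable (h i x) y.
Proof. by apply: differentiable_joint_y; exact: (Ch i).1.1. Qed.

(** Let [d] and [e] be the two blocks of [w]. The complementarity rows make [d] orthogonal to the
    active gradients and [e] zero off the active set; the stationarity rows then give [d = 0], in
    the linear case by the vertex property, and LICQ gives [e = 0]. *)
Lemma kkt_diff_injective (X : set 'rV[R]_n) mu x y (lam : 'rV[R]_k) :
  A3_LICQ g h X -> (SC_assum g h X mu \/ LIN_assum g h X) ->
  X x -> SCSC g h x -> ll_sol g h x y -> KKT_mult g h x y (fun i => lam 0 i) ->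
  forall w, kkt_diff ((x, 0), row_mx y lam) (0, w) = 0 -> w = 0.
Proof.
move=> licq sclin Xx scsc ysol kkt w.
pose d := lsubmx w; pose e i := w 0 (rshift m i).
have [lam0 [cs stat]] := kkt; have [yf ymin] := ysol.
rewrite /kkt_diff /= row_mxKl -/d -(row_mx0 _ 1 m k) => /eq_row_mx[H1 H2].
have {}H1 j : 'D_((0, d) : T) (fun p => 'D_(E j) (joint g) p) (x, y) +
     \sum_i (e i * 'D_(E j) (joint (h i)) (x, y) +
             lam 0 i * 'D_((0, d) : T) (fun p => 'D_(E j) (joint (h i)) p) (x, y)) = 0.
  move/rowP/(_ j): H1; rewrite mxE [X in _ = X]mxE => H; rewrite -[RHS]H; congr (_ + _).
  by apply: eq_bigr => i _; rewrite row_mxEr.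
have {}H2 i : e i * h i x y + lam 0 i * 'D_d (h i x) y = 0.
  move/rowP/(_ i): H2; rewrite mxE row_mxEr addr0 [X in _ = X]mxE => H; rewrite -[RHS]H.
  by rewrite derive_joint_y.
have act i : h i x y = 0 -> 'D_d (h i x) y = 0.
  move=> hi; have := H2 i; rewrite hi mulr0 add0r => /eqP; rewrite mulf_eq0.
  by rewrite gt_eqF ?(scsc y ysol _ kkt i hi)//= => /eqP.
have inact i : h i x y <> 0 -> e i = 0.
  move=> /eqP hi; have /eqP := cs i; rewrite mulf_eq0 (negbTE hi) orbF => /eqP li.
  by have /eqP := H2 i; rewrite li mul0r addr0 mulf_eq0 (negbTE hi) orbF => /eqP.
have d0 : d = 0.
  case: sclin => [[mu0 sc]|lin]; last first.
    have [ag [ah cf]] := lin x Xx.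
    exact: (linear_program_active_span (dgy x) (fun i => dhy i x) ag ah cf scsc ysol kkt act).
  have [sg ch] := sc x Xx.
  have Hg := hessian_strongly_convex y d Cg sg.
  have Hh i := hessian_strongly_convex y d (Ch i) (convex_strongly0 (ch i)).
  (* Pairing the stationarity rows with [d] cancels the terms in [e] and leaves the Hessian form of
     the Lagrangian. *)
  have S0 : \sum_j d 0 j * 'D_((0, d) : T) (fun p => 'D_(E j) (joint g) p) (x, y) +
      \sum_i lam 0 i * \sum_j d 0 j * 'D_((0, d) : T) (fun p => 'D_(E j) (joint (h i)) p) (x, y) = 0.
    have : \sum_j d 0 j * ('D_((0, d) : T) (fun p => 'D_(E j) (joint g) p) (x, y) +
       \sum_i (e i * 'D_(E j) (joint (h i)) (x, y) +
             lam 0 i * 'D_((0, d) : T) (fun p => 'D_(E j) (joint (h i)) p) (x, y))) = 0.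
      by rewrite big1// => j _; rewrite H1 mulr0.
    under eq_bigr => j _ do rewrite mulrDr mulr_sumr.
    rewrite big_split/= exchange_big/= => HH.
    rewrite -[RHS]HH; congr (_ + _); apply: eq_bigr => i _.
    under [in RHS]eq_bigr => j _ do rewrite mulrDr.
    rewrite big_split/= (_ : \sum_i0 d 0 i0 * (e i * _) = e i * 'D_d (h i x) y).
      have -> : e i * 'D_d (h i x) y = 0.
        have [/act->|/eqP/inact->] := eqVneq (h i x y) 0; first by rewrite mulr0.
        by rewrite mul0r.
      by rewrite add0r mulr_sumr; apply: eq_bigr => j _; rewrite mulrCA.
    rewrite derive_grad// mulr_sumr; apply: eq_bigr => j _.
    by rewrite [grad _ _ 0 j]mxE derive_joint_y mulrCA.
  have Sh : 0 <= \sum_i lam 0 i * \sum_j d 0 j *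
      'D_((0, d) : T) (fun p => 'D_(E j) (joint (h i)) p) (x, y).
    apply: sumr_ge0 => i _; apply: mulr_ge0; first exact: lam0.
    by have := Hh i; rewrite mul0r.
  have : sqnorm d <= 0.
    have : mu * sqnorm d <= 0 by lra.
    by rewrite pmulr_rle0.
  move=> /(le_trans (sqr_norm_le d)); rewrite exprn_even_le0//= normr_eq0.
  by move=> /eqP.
have e0 i : e i = 0.
  apply: (licq x Xx y ysol) => //; apply/rowP => j; rewrite summxE mxE.
  rewrite -[RHS](H1 j) d0.
  have D0 (G : T -> R) : 'D_((0, 0) : T) G (x, y) = 0 by exact: derive0.
  rewrite D0 add0r; apply: eq_bigr => l _.
  by rewrite D0 mulr0 addr0 !mxE derive_joint_y.
rewrite -[LHS]hsubmxK -/d d0; congr row_mx.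
by apply/rowP => i; rewrite !mxE; exact: e0.
Qed.

End KKTMap.

(** * Chain rule along a selection, and passage to the limit *)

Section Assembly.
Variable R : realType.

Lemma cvg_row (T : Type) (F : set_system T) N (G : T -> 'rV[R]_N) (l : 'rV[R]_N) :
  Filter F -> (forall j, G u 0 j @[u --> F] --> l 0 j) -> G @ F --> l.
Proof.
move=> FF H; apply/cvgrPdist_le => e e0.
have Hall : \forall u \near F, forall j, `|l 0 j - G u 0 j| <= e.
  by apply: filter_forall => j; move/cvgrPdist_le: (H j) => /(_ e e0).
apply: filterS Hall => u Hu; apply: row_norm_le => [|j]; first exact: ltW.
by rewrite !mxE.
Qed.

Lemma cvg_pair_point (T : Type) (F : set_system T) (V W : normedModType R)
    (f : T -> V) (g : T -> W) (a : V) (b : W) :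
  Filter F -> f @ F --> a -> g @ F --> b -> (f u, g u) @[u --> F] --> (a, b).
Proof. by move=> FF fa gb; exact: (cvg_pair fa gb). Qed.

Lemma derive_selection n m (f : 'rV[R]_n -> 'rV[R]_m -> R) (Y : 'rV[R]_n -> 'rV[R]_m) x v :
  differentiable (joint f) (x, Y x) -> differentiable Y x ->
  'D_v (fun x' => f x' (Y x')) x =
  'D_((v, 0) : 'rV[R]_n * 'rV[R]_m) (joint f) (x, Y x) +
  \sum_j ('D_v Y x) 0 j * 'D_((0, evec R j) : 'rV[R]_n * 'rV[R]_m) (joint f) (x, Y x).
Proof.
move=> df dY.
have E : (fun x' => f x' (Y x')) = joint f \o (fun x' => (x', Y x')) by [].
have dp : differentiable (fun x' => (x', Y x')) x by exact: differentiable_pair.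
rewrite E deriveE; last exact: differentiable_comp.
have dE : 'd (fun x' => (x', Y x')) x v = (v, 'D_v Y x).
  by rewrite diff_pair//= -!deriveE// derive_id.
rewrite diff_comp//= dE.
have -> : (v, 'D_v Y x) = (v, 0) + (0, 'D_v Y x) :> 'rV[R]_n * 'rV[R]_m.
  by congr pair; rewrite /= ?addr0 ?add0r.
rewrite linearD -!deriveE//; congr (_ + _).
rewrite diff_pair_basis//= big1 ?add0r// => i _.
by rewrite mxE mul0r.
Qed.

(** Shows that the hypergradient formula is the gradient of the composite, so both sides of the
    limit expand by one chain rule. *)
Lemma grad_selection n m (f : 'rV[R]_n -> 'rV[R]_m -> R) (Y : 'rV[R]_n -> 'rV[R]_m) x i :
  differentiable (joint f) (x, Y x) -> differentiable Y x ->
  grad_phi f Y x 0 i = 'D_(evec R i) (fun x' => f x' (Y x')) x.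
Proof.
move=> df dY; rewrite derive_selection// /grad_phi !mxE derive_joint_x; congr (_ + _).
by apply: eq_bigr => j _; rewrite !mxE derive_joint_y mulrC.
Qed.

End Assembly.

Unset Implicit Arguments.

Theorem theorem5 (R : realType) (n m k : nat)
  (f g : 'rV[R]_n -> 'rV[R]_m -> R) (h : 'I_k -> 'rV[R]_n -> 'rV[R]_m -> R)
  (X : set 'rV[R]_n) (mu : R) :
  A1 f g h -> A2 h X -> A3_LICQ g h X ->
  (SC_assum g h X mu \/ LIN_assum g h X) ->
  forall x : 'rV[R]_n, X x -> SCSC g h x ->
  exists Y : 'rV[R]_n -> 'rV[R]_m,
    diff_selection (ll_sol g h) X x Y /\
    exists Yt : R -> 'rV[R]_n -> 'rV[R]_m,
      (\forall t \near 0^'+, diff_selection (barrier_sol g h t) X x (Yt t)) /\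
      (fun t => grad_phit f (Yt t) x) @ 0^'+ --> grad_phi f Y x.
Proof.
move=> [Cf [Cg Ch]] [_ [_ slater]] licq sclin x Xx scsc.
have dg x' y : differentiable (g x') y by apply: differentiable_joint_y; exact: Cg.1.1.
have dh i x' y : differentiable (h i x') y by apply: differentiable_joint_y; exact: (Ch i).1.1.
have cvx x' : X x' -> convex_fun (g x') /\ forall i, convex_fun (h i x').
  move=> Xx'; case: sclin => [[mu0 /(_ _ Xx')[cg ch]]|/(_ _ Xx')[ag [ah _]]].
    by split=> //; exact: strongly_convex_convex (ltW mu0) cg.
  by split=> [|i]; apply: affine_convex.
have [y0 ysol] : ll_sol g h x !=set0.
  have f0 : feas h x !=set0.
    by have [y sy] := slater x Xx; exists y => i; rewrite ltW.
  case: sclin => [[mu0 /(_ _ Xx)[cg ch]]|/(_ _ Xx)[ag [ah cf]]].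
    exact: (ll_sol_strongly_convex (dg x) (fun i => dh i x) mu0 cg).
  exact: ll_sol_compact.
have [lam0f kkt0] := KKT_mult_exists (dg x) (fun i => dh i x) ysol (licq x Xx y0 ysol).
pose lam0 : 'rV[R]_k := \row_i lam0f i.
have lam0E : (fun i => lam0 0 i) = lam0f by apply/funext => i; rewrite mxE.
rewrite -lam0E in kkt0.
pose F := kkt_map g h; pose p0 := (x, 0 : R); pose z0 := row_mx y0 lam0.
have F0 : F (p0, z0) = 0.
  by apply/kkt_map0P; split; [exact: kkt0.2.2|move=> i; rewrite kkt0.2.1 oppr0].
have sF u := strict_diff_kkt Cg Ch u.
have injF := kkt_diff_injective Cg Ch licq sclin Xx scsc ysol kkt0.
have [zeta zeta0 Hzeta] := implicit_function_nearby
  (fun u => ex_intro _ _ (sF u)) F0 (sF _) injF.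
pose y p := lsubmx (zeta p); pose lam p i := zeta p 0 (rshift m i).
have y0E : y p0 = y0 by rewrite /y zeta0 row_mxKl.
have lamE i : lam p0 i = lam0 0 i by rewrite /lam zeta0 row_mxEr.
have [_ [M0 sz0] _] := nbhs_singleton Hzeta.
have czeta : zeta p @[p --> p0] --> zeta p0.
  exact: (differentiable_continuous (strict_diff_differentiable sz0).1).
have bls := @blin_lsubmx R m k.
have cy : y p @[p --> p0] --> y p0.
  apply: (cvg_comp _ _ czeta); exact: (blin_continuous bls).
have clam i : lam p i @[p --> p0] --> lam p0 i.
  exact: (cvg_comp zeta (fun v : 'rV[R]_(m + k) => v 0 (rshift m i) : R) czeta
    (blin_continuous (@blin_entry R (m + k) (rshift m i)) (x := _))).
have cxy : (p.1, y p) @[p --> p0] --> (x, y0).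
  by apply: (cvg_pair_point (f := fst) (g := y)); [exact: cvg_fst|rewrite -y0E].
(* Only one sign per constraint persists by continuity: that of the multiplier if active (by SCSC),
   that of the constraint if inactive. The other follows from [lam_i h_i = - t]. *)
have sign1 i : \forall p \near p0,
    (h i x y0 = 0 -> 0 < lam p i) /\ (h i x y0 <> 0 -> h i p.1 (y p) < 0).
  have [hi|/eqP hi] := eqVneq (h i x y0) 0.
    have l0 : 0 < lam p0 i by rewrite lamE; exact: (scsc y0 ysol _ kkt0).
    by near=> p; split=> // _; near: p; exact: (cvgr_gt _ (clam i)).
  have hneg : h i x y0 < 0 by rewrite lt_neqAle ysol.1 andbT; exact/eqP.
  have ch : joint (h i) (p.1, y p) @[p --> p0] --> joint (h i) (x, y0).
    exact: (cvg_comp _ _ cxy (differentiable_continuous ((Ch i).1.1 (x, y0)))).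
  near=> p; split=> // _; near: p; exact: (cvgr_lt _ ch).
have sign_near : \forall p \near p0, forall i,
    (h i x y0 = 0 -> 0 < lam p i) /\ (h i x y0 <> 0 -> h i p.1 (y p) < 0).
  exact: (@filter_forall _ _ _ (nbhs p0) _ sign1).
have good : \forall p \near p0, [/\ F (p, zeta p) = 0,
    exists M, strict_diff zeta p M,
    exists2 e : R, 0 < e & forall z, `|z - zeta p| < e -> F (p, z) = 0 -> z = zeta p &
    forall i, (h i x y0 = 0 -> 0 < lam p i) /\ (h i x y0 <> 0 -> h i p.1 (y p) < 0)].
  near=> p.
  have [A B C] : [/\ F (p, zeta p) = 0, exists M, strict_diff zeta p M &
    exists2 e : R, 0 < e & forall z, `|z - zeta p| < e -> F (p, z) = 0 -> z = zeta p].
    by near: p.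
  by split=> //; near: p.
have /nbhs_ballP[r /= r0 Hr] := good.
have inball x' t : `|x - x'| < r -> `|t| < r -> ball p0 r (x', t).
  by move=> H1 H2; split; rewrite -ball_normE/= ?sub0r ?normrN.
(* Freezing the multiplier at its value in [zeta] turns local uniqueness of the pair into local
   uniqueness of [y], the form used by the uniqueness lemmas. *)
have system x' t : `|x - x'| < r -> `|t| < r ->
    perturbed_KKT g h x' (lam (x', t)) t (y (x', t)) /\
    exists2 e : R, 0 < e & forall z, `|z - y (x', t)| < e ->
      perturbed_KKT g h x' (lam (x', t)) t z -> z = y (x', t).
  move=> x'r tr; have [Fp _ [e e0 He] _] := Hr _ (inball _ _ x'r tr).
  have zE : zeta (x', t) = row_mx (y (x', t)) (\row_i lam (x', t) i).
    rewrite -[LHS]hsubmxK; congr row_mx; apply/rowP => i; by rewrite !mxE.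
  have lE : (fun i => (\row_i lam (x', t) i) 0 i) = lam (x', t).
    by apply/funext => i; rewrite mxE.
  split; first by rewrite -lE; apply/kkt_map0P; rewrite -zE.
  exists e => // z zy Hz.
  suff : row_mx z (\row_i lam (x', t) i) = zeta (x', t).
    by move=> /(congr1 lsubmx); rewrite row_mxKl.
  apply: He; last by apply/kkt_map0P; rewrite lE.
  rewrite zE opp_row_mx add_row_mx subrr; apply: (le_lt_trans _ zy).
  apply: row_norm_le => // j; case: (split_ordP j) => i ->.
    by rewrite row_mxEl row_entry_le.
  by rewrite row_mxEr mxE normr0.
have semb t : strict_diff (fun x' => (x', t)) x (fun v : 'rV[R]_n => (v, 0 : R)).
  exact: (strict_diff_pair (strict_diff_blin _ (blin_id _)) (strict_diff_cst _ _)).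
have sy t : `|t| < r -> exists2 M, strict_diff zeta (x, t) M &
    strict_diff (fun x' => y (x', t)) x (fun v => lsubmx (M (v, 0))).
  move=> tr; have xr : `|x - x| < r by rewrite subrr normr0.
  have [_ [M sM] _ _] := Hr _ (inball x t xr tr).
  exists M => //.
  exact: (strict_diff_comp (strict_diff_comp (semb t) sM) (strict_diff_blin _ bls)).
have r00 : `|0 : R| < r by rewrite normr0.
(* Both selections are slices of the same implicit function, defined on one ball in [x'] for all
   small [t]. *)
pose Y x' := y (x', 0); pose Yt t x' := y (x', t).
exists Y; split.
  split; last by have [M _ /strict_diff_differentiable[]] := sy 0 r00.
  apply/nbhs_ballP; exists r => // x'; rewrite -ball_normE/= => x'r Xx'.
  have [sys uniq] := system x' 0 x'r r00; have [cg ch] := cvx _ Xx'.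
  have [_ _ _ sgn] := Hr _ (inball _ _ x'r r00).
  apply: (ll_sol_unique (dg x') (fun i => dh i x') cg ch _ sys uniq) => // i.
    have [/(sgn i).1/ltW//|/eqP/(sgn i).2 hneg] := eqVneq (h i x y0) 0.
    have /eqP := sys.2 i; rewrite oppr0 mulf_eq0 [X in _ || X]lt_eqF// orbF => /eqP->.
    exact: lexx.
  have [/(sgn i).1 l0|/eqP/(sgn i).2/ltW//] := eqVneq (h i x y0) 0.
  by have /eqP := sys.2 i; rewrite oppr0 mulf_eq0 gt_eqF//= => /eqP->; exact: lexx.
exists Yt; split.
  near=> t.
  have t0 : 0 < t by near: t; exact: nbhs_right_gt.
  have tr : `|t| < r by rewrite gtr0_norm//; near: t; exact: nbhs_right_lt.
  split; last by have [M _ /strict_diff_differentiable[]] := sy t tr.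
  apply/nbhs_ballP; exists r => // x'; rewrite -ball_normE/= => x'r Xx'.
  have [sys uniq] := system x' t x'r tr; have [cg ch] := cvx _ Xx'.
  have [_ _ _ sgn] := Hr _ (inball _ _ x'r tr).
  have both i : 0 < lam (x', t) i /\ h i x' (y (x', t)) < 0.
    have := sys.2 i => sysi.
    have [/(sgn i).1 l0|/eqP/(sgn i).2 hneg] := eqVneq (h i x y0) 0.
      by split=> //; rewrite -(pmulr_rlt0 _ l0) sysi oppr_lt0.
    by split=> //; rewrite -(nmulr_llt0 _ hneg) sysi oppr_lt0.
  apply: (barrier_sol_unique (dg x') (fun i => dh i x') cg ch _ sys uniq) => // i.
    by rewrite ltW// (both i).1.
  exact: (both i).2.
have dYt t : `|t| < r -> differentiable (Yt t) x.
  by move=> /sy[M _ /strict_diff_differentiable[]].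
have DYt t v : `|t| < r -> 'D_v (Yt t) x = lsubmx ('D_((v, 0) : 'rV[R]_n * R) zeta (x, t)).
  move=> /sy[M sM /strict_diff_differentiable[_ ->]].
  by rewrite (strict_diff_differentiable sM).2.
have ct : (x, t) @[t --> 0^'+] --> p0.
  apply: (cvg_pair_point (f := fun=> x) (g := id)); first exact: cvg_cst.
  by apply: cvg_at_right_filter; exact: cvg_id.
(* The key to the limit: strictness at [p0] and differentiability nearby make the derivative of
   [zeta] continuous at [p0]. *)
have cDzeta w : 'D_w zeta p @[p --> p0] --> 'D_w zeta p0.
  rewrite (strict_diff_differentiable sz0).2; apply: strict_diff_derive_cvg => //.
  apply: filterS Hzeta => p [_ [M sM] _].
  exact: diff_derivable (strict_diff_differentiable sM).1.
apply: cvg_row => i.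
rewrite (_ : grad_phi f Y x 0 i = 'D_((evec R i, 0) : 'rV[R]_n * 'rV[R]_m) (joint f) (x, Y x) +
  \sum_j lsubmx ('D_((evec R i, 0) : 'rV[R]_n * R) zeta (x, 0)) 0 j *
    'D_((0, evec R j) : 'rV[R]_n * 'rV[R]_m) (joint f) (x, Y x)); last first.
  rewrite grad_selection ?derive_selection ?DYt//; try exact: Cf.1; exact: (dYt 0 r00).
have cxY : (x, Yt t x) @[t --> 0^'+] --> (x, Y x).
  apply: (cvg_pair_point (f := fun=> x) (g := fun t => Yt t x)); first exact: cvg_cst.
  exact: (cvg_comp _ _ ct cy).
have cDf v : 'D_v (joint f) (x, Yt t x) @[t --> 0^'+] --> 'D_v (joint f) (x, Y x).
  exact: (cvg_comp _ _ cxY (Cf.2 v _)).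
have lim_expr : 'D_((evec R i, 0) : 'rV[R]_n * 'rV[R]_m) (joint f) (x, Yt t x) +
  \sum_j lsubmx ('D_((evec R i, 0) : 'rV[R]_n * R) zeta (x, t)) 0 j *
    'D_((0, evec R j) : 'rV[R]_n * 'rV[R]_m) (joint f) (x, Yt t x) @[t --> 0^'+] -->
  'D_((evec R i, 0) : 'rV[R]_n * 'rV[R]_m) (joint f) (x, Y x) +
  \sum_j lsubmx ('D_((evec R i, 0) : 'rV[R]_n * R) zeta (x, 0)) 0 j *
    'D_((0, evec R j) : 'rV[R]_n * 'rV[R]_m) (joint f) (x, Y x).
  apply: cvgD; first exact: cDf.
  apply: cvg_big => //; first exact: add_continuous.
  move=> j _; apply: cvgM; last exact: cDf.
  have bj := blin_comp bls (@blin_entry R m j).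
  have cD := cvg_comp _ _ ct (cDzeta ((evec R i, 0) : 'rV[R]_n * R)).
  exact: (cvg_comp _ (fun v : 'rV[R]_(m + k) => lsubmx v 0 j) cD
    (blin_continuous bj (x := _))).
(* The chain rule identifies the barrier gradient with this expression only for [t] below [r], which
   is enough for the limit. *)
apply: cvg_trans lim_expr; apply: near_eq_cvg; near=> t.
have tr : `|t| < r.
  rewrite gtr0_norm; last by near: t; exact: nbhs_right_gt.
  by near: t; exact: nbhs_right_lt.
rewrite /grad_phit mxE derive_selection ?DYt//; try exact: Cf.1; exact: dYt.
Unshelve. all: by end_near. Qed.
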